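(* Let $p$ be a prime number, let $\mathrm{M}\in\mathrm{GL}(2,\mathbb{Q})$ and $s\in\mathbb{Q}^2$, and let $F:\mathbb{Q}^2\to\mathbb{Q}^2$ be the affine map $F(z)=\mathrm{M}z+s$. Let $T=\mathrm{tr}(\mathrm{M})$ and $D=\det(\mathrm{M})$. If $s=(0,0)$, then for almost all $z\in\mathbb{Q}^2$ we have: (i) if $\nu_p(D)>2\nu_p(T)$, then $h_p(z)=-\nu_p(T)$; (ii) if $\nu_p(D)\leqslant 2\nu_p(T)$, then $h_p(z)=-\nu_p(D)/2$. If $s\neq(0,0)$, then for almost all $z\in\mathbb{Q}^2$ we have: (i) if $\nu_p(D)>2\nu_p(T)$, then $h_p(z)=\max(-\nu_p(T),0)$; (ii) if $\nu_p(D)\leqslant 2\nu_p(T)$, then $h_p(z)=\max(-\nu_p(D)/2,0)$.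
   Context: For a prime $p$, $\nu_p$ denotes the $p$-adic valuation on $\mathbb{Q}$, with $\nu_p(0)=\infty$. For $z=(x,y)\in\mathbb{Q}^2$ put $\nu_p(z)=\min(\nu_p(x),\nu_p(y))$. The $p$-adic (local) height of the initial point $z$ of an orbit of $F$ is $$h_p(z)=\lim_{t\to\infty}\,-\frac{1}{t}\,\nu_p(F^t(z)),$$ if the limit exists; a stated value of $h_p(z)$ means that the limit exists and has that value. ''Almost all'' refers to density with respect to points of bounded height. The height of a rational number $m/n$ with $\gcd(m,n)=1$ is $H(m/n)=\max(|m|,|n|)$; for $z=(x,y)\in\mathbb{Q}^2$, $H(z)=\max(H(x),H(y))$. Let $\mathcal{B}_N=\{z\in\mathbb{Q}^2: H(z)\leqslant N\}$, a finite set. The density of $A\subset X\subset\mathbb{Q}^2$ in $X$ is $$\mu(A)=\lim_{N\to\infty}\frac{\#(A\cap\mathcal{B}_N)}{\#(X\cap\mathcal{B}_N)}$$ if the limit exists. A property holds for almost all points of $X$ if the set $A$ of points of $X$ having the property satisfies $\mu(A)=1$. Here $X=\mathbb{Q}^2$. *)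

(* Defs.v *)
From HB Require Import structures.
From mathcomp Require Import all_boot all_order all_algebra.
From mathcomp Require Import finmap.
From mathcomp Require Import all_classical all_reals all_analysis.

Set Implicit Arguments.
Unset Strict Implicit.
Unset Printing Implicit Defensive.

Import Order.TTheory GRing.Theory Num.Theory.
Import numFieldNormedType.Exports.

Local Open Scope classical_set_scope.
Local Open Scope ring_scope.

(* Points of the rational plane are column vectors [z : 'cV[rat]_2], with
   coordinates [z 0 0] and [z 1 0]. *)

(* Valued in [\bar R] rather than in the integers with infinity, so that
   valuations, their rescalings and limits live in a single type. *)
Definition padic_val (R : realType) (p : nat) (x : rat) : \bar R :=
  if x == 0 then +oo%E
  else ((logn p `|numq x|%N)%:R - (logn p `|denq x|%N)%:R)%:E.

Definition padic_val2 (R : realType) (p : nat) (z : 'cV[rat]_2) : \bar R :=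
  mine (padic_val R p (z 0 0)) (padic_val R p (z 1 0)).

(* The limit is taken in [\bar R] because the orbit may meet the origin, where
   the valuation is infinite; the term at [t = 0] is irrelevant. The statement
   asserts both that the limit exists and that it equals [h]. *)
Definition has_padic_height (R : realType) (p : nat)
    (F : 'cV[rat]_2 -> 'cV[rat]_2) (z : 'cV[rat]_2) (h : \bar R) : Prop :=
  (fun t : nat => (- (t%:R)^-1)%:E * padic_val2 R p (iter t F z))%E @ \oo --> h.

(* [numq x] and [denq x] are coprime, so this is max(|m|, |n|) for x = m/n in
   lowest terms. *)
Definition rat_height (x : rat) : nat := maxn `|numq x|%N `|denq x|%N.

Definition point_height (z : 'cV[rat]_2) : nat :=
  maxn (rat_height (z 0 0)) (rat_height (z 1 0)).

Definition height_ball (N : nat) : set 'cV[rat]_2 :=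
  [set z | (point_height z <= N)%N].

(* [fset_set] is only meaningful on finite sets; see [finite_height_ball]. *)
Definition ball_count (A : set 'cV[rat]_2) (N : nat) : nat :=
  #|` fset_set (A `&` height_ball N)|.

Definition has_density (R : realType) (X A : set 'cV[rat]_2) (d : R) : Prop :=
  (fun N : nat => (ball_count A N)%:R / (ball_count X N)%:R : R) @ \oo --> d.

Definition almost_all (R : realType) (X : set 'cV[rat]_2)
    (P : 'cV[rat]_2 -> Prop) : Prop :=
  has_density X [set z | X z /\ P z] (1 : R).

Definition affine_map (M : 'M[rat]_2) (s : 'cV[rat]_2) (z : 'cV[rat]_2) :
  'cV[rat]_2 := M *m z + s.

Lemma finite_height_ball (N : nat) : finite_set (height_ball N).
Proof.
pose f (z : 'cV[rat]_2) := (numq (z 0 0), denq (z 0 0), (numq (z 1 0), denq (z 1 0))).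
have finZ : finite_set [set m : int | (`|m| <= N)%N].
  apply: (@sub_finite_set _ _
    ((Posz @` [set n | (n <= N)%N]) `|` (Negz @` [set n | (n <= N)%N]))).
    move=> [m|m] /= h; [left|right]; exists m => //=.
    exact: ltnW.
  have finN : finite_set [set n | (n <= N)%N].
    by rewrite (_ : [set n | _] = `I_N.+1) //; exact: finite_II.
  by rewrite finite_setU; split; apply: finite_image.
have f_inj : injective f.
  move=> z w [n0 d0 n1 d1]; apply/colP => i.
  have E x y : numq x = numq y -> denq x = denq y -> x = y :> rat.
    by move=> en ed; rewrite -[x]divq_num_den -[y]divq_num_den en ed.
  case: i => [[|[|//]]] lti.
    by rewrite (_ : Ordinal lti = 0); [exact: E|exact: val_inj].
  by rewrite (_ : Ordinal lti = 1); [exact: E|exact: val_inj].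
apply: (@sub_finite_set _ _ (f @^-1` (([set m : int | (`|m| <= N)%N] `*`
    [set m : int | (`|m| <= N)%N]) `*` ([set m : int | (`|m| <= N)%N] `*`
    [set m : int | (`|m| <= N)%N])))).
  move=> z; rewrite /height_ball /= /point_height /rat_height !geq_max.
  by move=> /andP[/andP[? ?] /andP[? ?]].
apply: finite_preimage; first by move=> x y _ _; exact: f_inj.
by do !apply: finite_setX.
Qed.

(* Main.v *)
Require Import Defs.
From HB Require Import structures.
From mathcomp Require Import all_boot all_order all_algebra all_field.
From mathcomp Require Import fingroup perm cyclic.
From mathcomp Require Import all_classical all_reals all_analysis.
From mathcomp Require Import zify ring lra.

(** The linear part obeys the recurrence [M ^ (t + 2) = T * M ^ (t + 1) - D * M ^ t].  Its
    Newton polygon gives the valuations of the two eigenvalues, and the whole dynamics can be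
    read off from this recurrence without extending the field of rational numbers: if the
    determinant term is the dominant one, the adjugate matrix reverses the motion and every
    nonzero vector moves at the rate [vp D / 2] ([pow_lower], [pow_upper]); if the trace term
    is, then either some step is dominated by it, and so are all later ones
    ([decay_dichotomy]), or the vector decays like the smaller eigenvalue, which confines it to
    a line ([fast_decay_cross]).  Lines have density zero ([collinear_thin]).

    For an affine map the increments of an orbit are linear orbits ([orbit_increment]).  At an
    expanding rate the orbit is as large as its increments; at a contracting rate it converges
    to the fixed point, which is not the origin.  In both cases the height is clear up to
    bounded terms ([expanding_upper], [contracting_upper]).

    The difficult case is rate zero.  The orbit is bounded, and it has to be shown that it
    does not approach the origin exponentially fast along a subsequence of times.  If 1 is not
    an eigenvalue, a close approach means that [M ^ t] is p-adically close to a fixed element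
    of the algebra generated by [M], and so that a power [mu ^ t] of an algebraic number is
    close to a fixed algebraic number [eta].  Counting and gap principles do not
    exclude that this happens for many initial points, since a power can be close to [eta] at
    very sparse times; Diophantine approximation does ([power_not_close]).  The proof is the
    classical one for two logarithms: a polynomial [P] in [X] and [Y] with small integer
    coefficients is chosen by the box principle so that [P (n, mu ^ n)] is divisible by a high
    power of [p] for all [n] ([vanishing_combination]).  If [eta] agrees with [mu ^ t] to many
    digits, then the values of [P] at the points [(r + t * s, mu ^ r * eta ^ s)] are divisible
    by the same power of [p], but too small for that unless they vanish, and a determinant
    argument shows that they do not all vanish ([zero_estimate]).  A precision proportional to
    the square of the cube root of [t] suffices.

    This covers irreducible characteristic polynomials with two unit roots
    ([irreducible_unit_sublinear], dimension two) and rational unit eigenvalues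
    ([scalar_affine], dimension one); roots of unity and irreducible polynomials with roots of
    different valuations are elementary ([finite_order_sublinear], [irreducible_mixed]). *)

Set Implicit Arguments.
Unset Strict Implicit.
Unset Printing Implicit Defensive.

(** * Choice of parameters *)

Lemma poly_leq_exp2 (C n l : nat) :
  C * n.+1 ^ n.+1 <= l.+1 -> C * l.+1 ^ n <= 2 ^ l.
Proof.
move=> hC.
have hl : l.+1 ^ n.+1 <= n.+1 ^ n.+1 * 2 ^ l.
  apply: (@leq_trans ((n.+1 * (l %/ n.+1).+1) ^ n.+1)).
    by rewrite leq_exp2r // mulnC ltn_ceil.
  rewrite expnMn leq_pmul2l ?expn_gt0 //.
  apply: (@leq_trans ((2 ^ (l %/ n.+1)) ^ n.+1)); first by rewrite leq_exp2r // ltn_expl.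
  by rewrite -expnM leq_exp2l // leq_trunc_div.
have n0 : 0 < n.+1 ^ n.+1 by rewrite expn_gt0.
rewrite -(leq_pmul2l n0); apply: leq_trans hl.
apply: (@leq_trans (l.+1 * l.+1 ^ n)); last by rewrite -expnS.
by rewrite mulnA leq_mul2r mulnC hC orbT.
Qed.

Lemma cube_root (t : nat) : exists l, l ^ 3 <= t < l.+1 ^ 3.
Proof.
elim: t => [|t [l /andP[h1 h2]]]; first by exists 0.
have [h|h] := ltnP t.+1 (l.+1 ^ 3); first by exists l; rewrite h (leq_trans h1).
by exists l.+1; rewrite h (leq_ltn_trans h2) // ltn_exp2r.
Qed.

(** Siegel-type bookkeeping.  With [l] about the cube root of [t], the free
    parameters have sizes [L ~ l], [S = rho ~ l], [K ~ l] and [E ~ l^2].  Thus [E] is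
    negligible against [t], while the archimedean bound is a product of four factors each
    at most [p ^ (k * l)] (from [K * L], [Bd], [n ^ K] and the heights), one of them strictly
    smaller, against a precision [p ^ E = p ^ (4 * k * l)].  The polynomial loss [n ^ K], with
    [n] of size about [t * S], is absorbed because [t] is polynomial in [l]. *)
Lemma parameters (p d h0 e : nat) : 1 < p -> 0 < h0 ->
  exists t0, forall t, t0 <= t -> exists E K L Bd rho S,
  [/\ 0 < E /\ e * E <= t, L * K <= rho * S, rho <= t,
      (p ^ (E * (d.+1 * d.+1))) ^ (K + E) < Bd ^ (K * L) &
      K * L * (Bd * (L + rho + t * S) ^ K *
        (d.+1 * h0) ^ ((L + rho + S) * L).+1) < p ^ E].
Proof.
move=> p1 h00.
have : 0 < d.+1 * d.+1 by rewrite muln_gt0.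
have : 0 < d.+1 * h0 by rewrite muln_gt0.
move: (d.+1 * d.+1) (d.+1 * h0) => D h hp D0.
have [sg sgE] : exists sg, sg = 36 * h * D by exists (36 * h * D).
have sg0 : 0 < sg by rewrite sgE muln_gt0 D0 muln_gt0 hp.
pose C1 := 4 * D + 20 * D * sg; pose C2 := 80 * D * sg ^ 2 * e.
have [m0 hm0] : exists m0, forall l, m0 <= l -> C1 ^ 5 * l.+1 ^ 20 <= 2 ^ l.
  exists (C1 ^ 5 * 20.+1 ^ 20.+1) => l hl.
  exact/poly_leq_exp2/leqW.
pose l0 := (m0 + 2 * C1 + 2 * C2).+1.
exists (l0 ^ 3) => t le_t.
have [l /andP[lt1 lt2]] := cube_root t.
have ll0 : l0 <= l by have := leq_ltn_trans le_t lt2; rewrite ltn_exp2r.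
have l_gt0 : 0 < l by apply: leq_trans ll0.
have hC1 : m0 <= l by apply: leq_trans ll0; rewrite /l0; lia.
have hC1' : 2 * C1 <= l by apply: leq_trans ll0; rewrite /l0; lia.
have hC2 : 2 * C2 <= l by apply: leq_trans ll0; rewrite /l0; lia.
clear ll0 le_t l0.
have [k kE] : exists k, k = 20 * D * sg ^ 2 * l.+1 by eexists.
have [S SE] : exists S, S = 20 * D * sg * l.+1 by eexists.
have [L LE] : exists L, L = 4 * D * l.+1 by eexists.
have k0 : 0 < k by rewrite kE muln_gt0 andbT muln_gt0 expn_gt0 sg0 muln_gt0 D0.
exists (4 * k * l), (5 * k), L, (p ^ (k * l)), S, S.
have pl : l ^ 3 = l * l * l by rewrite !expnS expn0 muln1 mulnA.
split.
- split; first by rewrite !muln_gt0 k0.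
  apply: leq_trans lt1; rewrite pl.
  have -> : e * (4 * k * l) = (C2 * l.+1) * l by rewrite kE /C2; ring.
  by rewrite leq_mul2r; apply/orP; right; nia.
- by rewrite LE SE kE; apply: eq_leq; ring.
- apply: leq_trans lt1; rewrite pl; apply: (@leq_trans (C1 * l.+1)); last by nia.
  by rewrite SE /C1 leq_mul2r leq_addl orbT.
- rewrite -!expnM ltn_exp2l //.
  have -> : 4 * k * l * D * (5 * k + 4 * k * l) = (k * l) * (4 * D * k * (5 + 4 * l)) by ring.
  rewrite ltn_pmul2l ?muln_gt0 ?k0 //.
  have -> : 5 * k * L = (4 * D * k) * (5 * l.+1) by rewrite LE; ring.
  by rewrite ltn_pmul2l ?muln_gt0 ?k0 ?D0 //; lia.
have bound_n : (L + S + t * S) ^ (5 * k) <= p ^ (k * l).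
  rewrite expnM (mulnC k) expnM leq_exp2r //.
  apply: (@leq_trans (2 ^ l)); last by rewrite leq_exp2r.
  have := hm0 l hC1; apply: leq_trans.
  have -> : C1 ^ 5 * l.+1 ^ 20 = (C1 * l.+1 ^ 4) ^ 5 by rewrite expnMn -expnM.
  rewrite leq_exp2r //; apply: (@leq_trans (C1 * l.+1 * t.+1)).
    by rewrite LE SE /C1; nia.
  by rewrite (expnS _ 3) mulnA leq_mul2l lt2 orbT.
have bound_H : h ^ ((L + S + S) * L).+1 <= p ^ (k * l).
  apply: (@leq_trans ((p ^ h) ^ ((L + S + S) * L).+1)).
    rewrite leq_exp2r //; apply: (@leq_trans (2 ^ h)); first by rewrite ltnW // ltn_expl.
    by rewrite leq_exp2r.
  rewrite -expnM leq_exp2l //.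
  have L0 : 0 < L by rewrite LE !muln_gt0 D0.
  have S0 : 0 < S by rewrite SE !muln_gt0 D0 sg0.
  apply: (@leq_trans (h * (2 * ((L + S + S) * L)))).
    by rewrite leq_mul2l; apply/orP; right; have : 0 < (L + S + S) * L; [rewrite muln_gt0; lia|lia].
  apply: (@leq_trans (h * (2 * ((44 * D * sg * l.+1) * (8 * D * l))))).
    have LSb : L + S + S <= 44 * D * sg * l.+1.
      have -> : 44 * D * sg * l.+1 = 4 * (D * l.+1 * sg) + S + S by rewrite SE; ring.
      rewrite !leq_add2r; have -> : L = 4 * (D * l.+1 * 1) by rewrite LE; ring.
      by rewrite leq_mul2l leq_mul2l sg0 orbT.
    have Lb : L <= 8 * D * l.
      have -> : 8 * D * l = 4 * D * (2 * l) by ring.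
      by rewrite LE leq_mul2l; apply/orP; right; lia.
    by rewrite leq_mul2l leq_mul2l leq_mul ?orbT.
  have -> : h * (2 * (44 * D * sg * l.+1 * (8 * D * l))) =
    (704 * h * D) * (D * sg * l.+1 * l) by ring.
  have -> : k * l = (20 * sg) * (D * sg * l.+1 * l) by rewrite kE; ring.
  rewrite leq_mul2r; apply/orP; right; rewrite sgE.
  have -> : 704 * h * D = 704 * (h * D) by ring.
  have -> : 20 * (36 * h * D) = 720 * (h * D) by ring.
  exact: leq_mul.
have bound_KL : 5 * k * L < p ^ (k * l).
  apply: (@leq_trans (2 ^ (k * l))); last by rewrite leq_exp2r // muln_gt0 k0.
  have kD : 40 * D <= k * l.
    have -> : k * l = (20 * D) * (sg ^ 2 * (l.+1 * l)) by rewrite kE; ring.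
    have -> : 40 * D = (20 * D) * 2 by ring.
    have sg20 : 0 < sg ^ 2 by rewrite expn_gt0 sg0.
    rewrite leq_mul2l; apply/orP; right; apply: (@leq_trans (1 * (l.+1 * l))); last first.
      by rewrite leq_mul2r sg20 orbT.
    by rewrite mul1n; apply: (@leq_trans (2 * 1)) => //; apply: leq_mul.
  apply: (@leq_ltn_trans ((k * l) * (k * l))).
    have -> : 5 * k * L = k * (20 * D * l.+1) by rewrite LE; ring.
    rewrite -[X in _ <= X]mulnA leq_mul2l; apply/orP; right.
    apply: (@leq_trans (l * (40 * D))); last by rewrite leq_mul2l kD orbT.
    have -> : l * (40 * D) = 20 * D * (2 * l) by ring.
    by rewrite leq_mul2l; apply/orP; right; lia.
  have h5 : 5 <= k * l.
    by apply: leq_trans kD; apply: (@leq_trans (40 * 1)); rewrite ?leq_mul2l.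
  move: (k * l) h5; elim=> [//|x IHx]; rewrite leq_eqVlt => /orP[/eqP<-//|].
  rewrite ltnS => h5; have := IHx h5; rewrite expnS mulSn mulnS.
  by have : 5 * x <= x * x; [rewrite leq_mul2r h5 orbT|]; move: (x * x) (2 ^ x) h5; clear; lia.
have -> : 4 * k * l = k * l + (k * l + k * l + k * l) by ring.
rewrite ![p ^ (_ + _)]expnD.
have P0 : 0 < p ^ (k * l) by rewrite expn_gt0; lia.
apply: (@leq_trans (p ^ (k * l) *
  (p ^ (k * l) * (L + S + t * S) ^ (5 * k) * h ^ ((L + S + S) * L).+1))).
  rewrite ltn_pmul2r // !muln_gt0 P0 !expn_gt0 hp.
  by rewrite addn_gt0 addn_gt0 LE !muln_gt0 D0.
by rewrite leq_mul2l leq_mul ?orbT // leq_mul.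
Qed.

Import Order.TTheory GRing.Theory Num.Theory.
Import numFieldNormedType.Exports.

Local Open Scope classical_set_scope.
Local Open Scope ring_scope.

(** * Zero estimate *)

Lemma coefM_top (F : comNzRingType) (p q : {poly F}) m n :
  (size p <= m.+1)%N -> (size q <= n.+1)%N ->
  (p * q)`_(m + n) = p`_m * q`_n.
Proof.
move=> hp hq; have lt_m : (m < (m + n).+1)%N by lia.
rewrite coefM (bigD1 (Ordinal lt_m)) //= addKn big1 ?addr0 // => -[j /= lt_j].
rewrite -val_eqE /= => /eqP ne_jm.
have [lt_jm|le_mj] := ltnP j m; last first.
  by rewrite [p`_j]nth_default ?mul0r //; apply: leq_trans hp _; lia.
by rewrite [q`_ _]nth_default ?mulr0 //; apply: leq_trans hq _; lia.
Qed.

Lemma coef_prod_top (F : comNzRingType) (I : Type) (s : seq I)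
    (f : I -> {poly F}) (d : I -> nat) :
  (forall i, size (f i) <= (d i).+1)%N ->
  (\prod_(i <- s) f i)`_(\sum_(i <- s) d i) = \prod_(i <- s) (f i)`_(d i).
Proof.
move=> hd.
suff [] : (size (\prod_(i <- s) f i)%R <= (\sum_(i <- s) d i).+1)%N /\
  (\prod_(i <- s) f i)`_(\sum_(i <- s) d i) = \prod_(i <- s) (f i)`_(d i) by [].
elim: s => [|i s [IHs IHc]]; first by rewrite !big_nil coef1 size_poly1.
rewrite !big_cons coefM_top // IHc; split=> //.
by apply: leq_trans (size_polyMleq _ _) _; have := hd i; lia.
Qed.

(** Think of [Q l] as the coefficient of [Y ^ l] in a polynomial in [X] and [Y], vanishing at
    many points [(r + t * s, mu ^ r * eta ^ s)] of a finitely generated subgroup of the product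
    of the additive and the multiplicative group.  At each of
    the [rho * S] abscissae the [L] translates of the polynomial by multiples of [(1, mu)]
    have a common nonzero solution [(y ^ l)], so the determinant of their coefficients
    vanishes there.  That determinant has degree below [L * K] in [X], and its top
    coefficient is a Vandermonde determinant in the distinct powers of [mu] times leading
    coefficients, which is not zero. *)
Lemma zero_estimate (F : numFieldType) (K L rho S t : nat)
    (Q : 'I_L -> {poly F}) (mu eta : F) :
  mu != 0 -> eta != 0 -> (forall n, (0 < n)%N -> mu ^+ n != 1) ->
  (forall l, size (Q l) <= K)%N -> (L * K <= rho * S)%N -> (rho <= t)%N ->
  (forall r s, (r < L + rho)%N -> (s < S)%N ->
    \sum_l (Q l).[(r + t * s)%:R] * (mu ^+ r * eta ^+ s) ^+ l = 0) ->
  forall l, Q l = 0.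
Proof.
move=> mu0 eta0 mu_inf sQ LK rho_t vanish.
suff: [forall l, Q l == 0] by move=> /forallP h l; apply/eqP.
apply/negPn/negP; rewrite negb_forall => /existsP[l0 Ql0].
have L0 : (0 < L)%N by exact: leq_ltn_trans (ltn_ord l0).
have K0 : (0 < K)%N by apply: leq_trans (sQ l0); rewrite size_poly_gt0.
(* Replacing zero columns keeps the full Vandermonde determinant; the common solution
   below has zero entries at these places. *)
pose Q' l := if Q l == 0 then 1 else Q l.
have Q'0 l : Q' l != 0 by rewrite /Q'; case: ifP => [_|->//]; exact: oner_neq0.
have sQ' l : (size (Q' l) <= K)%N by rewrite /Q'; case: ifP => // _; rewrite size_poly1.
pose G : 'M[{poly F}]_L :=
  \matrix_(i, l) (mu ^+ (i * l) *: (Q' l \Po ('X + i%:R%:P))).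
have sX (i : nat) : size ('X + i%:R%:P : {poly F}) = 2 by rewrite size_XaddC.
have sG i l : (size (G i l) <= size (Q' l))%N.
  by rewrite mxE; apply: leq_trans (size_scale_leq _ _) _; rewrite size_comp_poly2 ?sX.
(* [G] lists the coefficients in [Y] of the translates by [(i, mu ^ i)]. *)
have sdet : (size (\det G) <= L * K)%N.
  apply: leq_trans (size_sum _ _ _) _; apply/bigmax_leqP => sg _.
  rewrite -(rmorph_sign (@polyC F)) mul_polyC.
  apply: leq_trans (size_scale_leq _ _) _.
  apply: leq_trans (size_poly_prod_leq _ _) _; rewrite cardT size_enum_ord.
  have : (\sum_i size (G i (sg i)) <= \sum_(i < L) K)%N.
    by apply: leq_sum => i _; apply: leq_trans (sQ' (sg i)).
  rewrite sum_nat_const card_ord => h; rewrite leq_subLR; apply: leq_ltn_trans h _; lia.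
have detG0 : \det G != 0.
  pose D := (\sum_l (size (Q' l)).-1)%N.
  apply/eqP => detG0; have := coef0 F D; rewrite -detG0 coef_sum.
  under eq_bigr => sg _.
    have -> : D = (\sum_i (size (Q' (sg i))).-1)%N.
      by rewrite /D (reindex_inj (@perm_inj _ sg)).
    rewrite -(rmorph_sign (@polyC F)) coefCM coef_prod_top; last first.
      by move=> i; rewrite prednK ?size_poly_gt0.
    under eq_bigr => i _.
      rewrite mxE coefZ.
      have -> : (Q' (sg i) \Po ('X + i%:R%:P))`_(size (Q' (sg i))).-1 =
                lead_coef (Q' (sg i)).
        by rewrite -(size_comp_poly2 _ (sX i)) -lead_coefE lead_coef_comp ?sX //
           lead_coefXaddC expr1n mulr1.
      over.
    rewrite big_split /=.
    have -> : \prod_i lead_coef (Q' (sg i)) = \prod_i lead_coef (Q' i).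
      by rewrite [RHS](reindex_inj (@perm_inj _ sg)).
    rewrite mulrA.
    over.
  rewrite -big_distrl /= => /eqP; rewrite mulf_eq0 => /orP[|]; last first.
    by apply/negP/prodf_neq0 => i _; rewrite lead_coef_eq0.
  have -> : \sum_(sg : 'S_L) (-1) ^+ sg * \prod_(i < L) mu ^+ (i * sg i)%N =
     \det (Vandermonde L (\row_(i < L) mu ^+ i)).
    rewrite -det_tr; apply: eq_bigr => sg _; congr (_ * _).
    by apply: eq_bigr => i _; rewrite !mxE exprM.
  apply/negP; rewrite det_Vandermonde; apply/prodf_neq0 => i _.
  apply/prodf_neq0 => j lt_ij; rewrite !mxE -(subnKC (ltnW lt_ij)) exprD.
  rewrite -[X in _ - X]mulr1 -mulrBr mulf_neq0 ?expf_neq0 // subr_eq0.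
  by apply: mu_inf; rewrite subn_gt0.
pose rs := [seq ((r + t * s)%:R : F) | r <- iota 0 rho, s <- iota 0 S].
have := max_poly_roots (rs := rs) detG0.
have -> : size rs = (rho * S)%N by rewrite size_allpairs !size_iota.
move=> H; have: (rho * S < L * K)%N; last by rewrite ltnNge LK.
apply: leq_trans sdet; apply: H.
  apply/allP => x /allpairsP[[r s] /= []]; rewrite !mem_iota /= !add0n => hr hs ->.
  rewrite rootE -horner_evalE -det_map_mx -det_tr.
  apply/det0P; pose y := mu ^+ r * eta ^+ s.
  (* The powers of [y], restricted to the monomials that occur. *)
  exists (\row_l (if Q l == 0 then 0 else y ^+ l)).
    apply/eqP => /rowP/(_ l0); rewrite !mxE (negPf Ql0) => /eqP.
    by rewrite expf_eq0 mulf_eq0 !expf_eq0 (negPf mu0) (negPf eta0) !andbF.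
  apply/rowP => i; rewrite !mxE.
  rewrite -[RHS](vanish (r + i)%N s) //; last by have := ltn_ord i; lia.
  apply: eq_bigr => l _; rewrite !mxE /Q'; case: eqP => [->|_].
    by rewrite horner0 !mul0r.
  rewrite /= /horner_eval hornerZ horner_comp !hornerE.
  rewrite -natrD /y addnAC exprD !exprMn -!exprM /=; ring.
apply: allpairs_uniq; try exact: iota_uniq.
move=> [r s] [r' s'] /allpairsP[[a b]/= []] + _ [-> ->] /allpairsP[[a' b']/= []] + _ [-> ->].
rewrite !mem_iota /= !add0n => ha ha' /eqP; rewrite eqr_nat => /eqP e.
have eb : b = b'.
  have : ((a + t * b) %/ t = (a' + t * b') %/ t)%N by rewrite e.
  rewrite ![(t * _)%N]mulnC !divnDMl; try lia.
  by rewrite !divn_small; lia.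
by rewrite eb in e *; congr (_, _); lia.
Qed.

(** * The auxiliary function *)

Definition fdiff (V : zmodType) (f : nat -> V) (n : nat) : V := f n.+1 - f n.

(** Sequences killed by the [m]-th finite difference: they behave as polynomial functions
    of degree below [m], also over rings with torsion. *)
Definition poly_like (V : zmodType) (m : nat) (f : nat -> V) : Prop :=
  forall n, iter m (@fdiff V) f n = 0.

Section PolyLike.
Variable V : zmodType.
Implicit Types (f g : nat -> V) (m n : nat).

Lemma poly_like_ext m f g : f =1 g -> poly_like m f -> poly_like m g.
Proof. by move/funext ->. Qed.

Lemma poly_like0 f : (forall n, f n = 0) -> forall m, poly_like m f.
Proof.
move=> f0 m; have -> : f = fun=> 0 by apply/funext.
elim: m => [|m IHm] // n; rewrite iterSr.
have -> : @fdiff V (fun=> 0) = fun=> 0 by apply/funext => k; rewrite /fdiff subrr.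
exact: IHm.
Qed.

Lemma poly_likeD m f g :
  poly_like m f -> poly_like m g -> poly_like m (fun n => f n + g n).
Proof.
elim: m f g => [|m IHm] f g hf hg n; first by move: (hf n) (hg n) => /= -> ->; rewrite addr0.
rewrite iterSr; move: n; apply: (@poly_like_ext _ (fun n => fdiff f n + fdiff g n)).
  by move=> n; rewrite /fdiff opprD addrACA.
by apply: IHm => n; rewrite -iterSr.
Qed.

Lemma poly_like_sum (I : Type) (s : seq I) m (F : I -> nat -> V) :
  (forall i, poly_like m (F i)) -> poly_like m (fun n => \sum_(i <- s) F i n).
Proof.
move=> hF; elim: s => [|i s IHs].
  by apply: poly_like0 => n; rewrite big_nil.
apply: (@poly_like_ext _ (fun n => F i n + \sum_(j <- s) F j n)).
  by move=> n; rewrite big_cons.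
exact: poly_likeD.
Qed.

Lemma poly_like_shift m f : poly_like m f -> poly_like m (f \o succn).
Proof.
elim: m f => [|m IHm] f hf n; first exact: (hf n.+1).
by rewrite iterSr; apply: (IHm (fdiff f)) => k; rewrite -iterSr.
Qed.

Lemma poly_likeS m f : poly_like m f -> poly_like m.+1 f.
Proof. by move=> hf n; rewrite iterS /fdiff !hf subrr. Qed.

Lemma poly_like_le m m' f : (m <= m')%N -> poly_like m f -> poly_like m' f.
Proof.
by move=> /subnKC <- hf; elim: (_ - _)%N => [|k]; rewrite ?addn0 ?addnS // => /poly_likeS.
Qed.

Lemma poly_like_mulrn m f :
  poly_like m f -> poly_like m.+1 (fun n => f n *+ n).
Proof.
elim: m f => [|m IHm] f hf.
  by apply: poly_like0 => n; have /= -> := hf n; rewrite mul0rn.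
move=> n; rewrite iterSr; move: n.
have hdf : poly_like m (fdiff f) by move=> k; rewrite -iterSr.
apply: (@poly_like_ext _ (fun n => fdiff f n *+ n + f n.+1)).
  by move=> n; rewrite /fdiff mulrnBl mulrSr addrAC.
by apply: poly_likeD; [exact: IHm|exact: poly_like_shift].
Qed.

Lemma poly_like_mulrn_exp m k f :
  poly_like m f -> poly_like (k + m) (fun n => f n *+ n ^ k).
Proof.
move=> hf; elim: k => [|k IHk]; first by apply: poly_like_ext hf.
rewrite addSn; apply: (poly_like_ext _ (poly_like_mulrn IHk)) => n.
by rewrite -mulrnA -expnSr.
Qed.

Lemma poly_like_eq0 m f :
  poly_like m f -> (forall i, (i < m)%N -> f i = 0) -> forall n, f n = 0.
Proof.
elim: m f => [|m IHm] f hf f0; first exact: hf.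
have df0 : forall n, fdiff f n = 0.
  apply: IHm => [n|i lt_im]; first by rewrite -iterSr.
  by rewrite /fdiff !f0 ?subrr // ltnS ltnW.
elim=> [|n IHn]; first exact: f0.
by have := df0 n; rewrite /fdiff IHn subr0.
Qed.

End PolyLike.

(** Each finite difference of a power sequence of [U] pulls out a factor [U - 1], hence a
    factor [p]; modulo [p ^ e] the sequence is therefore polynomial of degree below [e].  This
    is the finite-difference form of p-adic analyticity of [U ^ n]. *)
Lemma poly_like_exp (A : pzRingType) (p e : nat) (U V W : A) :
  U = 1 + V *+ p -> W *+ p ^ e = 0 -> poly_like e (fun n => W * U ^+ n).
Proof.
move=> defU; elim: e W => [|e IHe] W hW.
  by apply: poly_like0 => n; rewrite -[W]mulr1n hW mul0r.
move=> n; rewrite iterSr; move: n.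
apply: (@poly_like_ext A e (fun n => (W * V *+ p) * U ^+ n)).
  move=> n; rewrite /fdiff exprS mulrA -mulrBl; congr (_ * _).
  by rewrite defU mulrDr mulr1 addrAC subrr add0r mulrnAr.
by apply: IHe; rewrite -mulrnA -expnS -mulrnAl hW mul0r.
Qed.

(** Dirichlet's box principle, as in Siegel's lemma: two coefficient vectors with entries
    in [0, B) have the same image, and their difference is the relation. *)
Lemma small_relation (G : finZmodType) (I J : finType) (F : I -> J -> G) (B : nat) :
  (#|G| ^ #|J| < B ^ #|I|)%N ->
  exists c : I -> int, [/\ exists i, c i != 0, forall i, (`|c i| < B)%N &
    forall j, \sum_i F i j *~ c i = 0].
Proof.
move=> ltGB.
pose ev (x : {ffun I -> 'I_B}) : {ffun J -> G} := [ffun j => \sum_i F i j *+ x i].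
have : ~~ injectiveb ev.
  apply/negP => /injectiveP /leq_card; rewrite !card_ffun card_ord leqNgt.
  by rewrite ltGB.
move=> /injectivePn[x [y ne_xy exy]].
exists (fun i => (x i)%:Z - (y i)%:Z); split.
- apply/existsP; move: ne_xy; apply: contraR; rewrite negb_exists => /forallP h.
  apply/eqP/ffunP => i; apply/val_inj/eqP; have := h i.
  by rewrite negbK subr_eq0 eqz_nat.
- by move=> i; have := ltn_ord (x i); have := ltn_ord (y i); lia.
- move=> j; have /ffunP/(_ j) := exy; rewrite !ffunE => /eqP.
  rewrite -subr_eq0 -sumrB => /eqP e; apply: etrans e.
  by apply: eq_bigr => i _; rewrite mulrzBr -!pmulrn.
Qed.

Definition dvdmx (m : nat) a b (X : 'M[int]_(a, b)) : Prop :=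
  forall i j, (m%:Z %| X i j)%Z.

Lemma intr_Zp_eq0 (m : nat) (n : int) : (1 < m)%N ->
  (n%:~R == 0 :> 'Z_m) = (m%:Z %| n)%Z.
Proof.
move=> m1.
have natc (k : nat) : (k%:R == 0 :> 'Z_m) = (m %| k)%N.
  by rewrite -val_eqE /= val_Zp_nat.
case: n => k; first by rewrite -pmulrn natc dvdzE.
by rewrite NegzE mulrNz oppr_eq0 -pmulrn natc dvdzE abszN.
Qed.

Lemma map_mx_Zp_eq0 (m a b : nat) (X : 'M[int]_(a, b)) : (1 < m)%N ->
  map_mx (intr : int -> 'Z_m) X = 0 <-> dvdmx m X.
Proof.
move=> m1; split=> [/matrixP h i j|h].
  by have /eqP := h i j; rewrite !mxE intr_Zp_eq0.
by apply/matrixP => i j; rewrite !mxE; apply/eqP; rewrite intr_Zp_eq0 //; exact: h.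
Qed.

(** The auxiliary function: an exponential polynomial in [n] with small integer
    coefficients.  The box principle makes it vanish modulo [p ^ E] at the first [K + E]
    integers only, and the finite-difference bound propagates this to all [n]. *)
Lemma vanishing_combination (p E d K L B : nat) (U V : 'M[int]_d.+1) :
  (1 < p)%N -> (0 < E)%N -> U = 1 + V *+ p ->
  ((p ^ (E * (d.+1 * d.+1))) ^ (K + E) < B ^ (K * L))%N ->
  exists c : 'I_K * 'I_L -> int, [/\ exists i, c i != 0,
    forall i, (`|c i| < B)%N &
    forall n, dvdmx (p ^ E) (\sum_(i : 'I_K * 'I_L) U ^+ (n * i.2) *~ (c i * (n ^ i.1)%:Z))].
Proof.
move=> p1 E0 defU ltB; set m := (p ^ E)%N.
have m1 : (1 < m)%N by rewrite -(exp1n E) ltn_exp2r.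
pose f : {rmorphism int -> 'Z_m} := intr.
pose Um : 'M['Z_m]_d.+1 := map_mx f U.
pose F (i : 'I_K * 'I_L) (j : 'I_(K + E)) : 'M['Z_m]_d.+1 :=
  Um ^+ (j * i.2) *+ j ^ i.1.
have [|c [c0 cB cF]] := @small_relation _ _ _ F B.
  move: ltB; rewrite card_prod !card_ord card_mx card_ord (Zp_cast m1) => ltB.
  by rewrite /m -(expnM p).
exists c; split=> // n; apply/map_mx_Zp_eq0 => //.
have -> : map_mx f (\sum_(i : 'I_K * 'I_L) U ^+ (n * i.2) *~ (c i * (n ^ i.1)%:Z)) =
    \sum_(i : 'I_K * 'I_L) (Um ^+ (n * i.2) *+ n ^ i.1) *~ c i.
  rewrite raddf_sum /=; apply: eq_bigr => i _.
  by rewrite raddfMz /= rmorphXn /= mulrC mulrzA -pmulrn.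
move: n; apply: (@poly_like_eq0 _ (K + E)) => [|j ltj]; last first.
  exact: (cF (Ordinal ltj)).
apply: poly_like_sum => -[k l] /=.
have -> : (fun n => (Um ^+ (n * l) *+ n ^ k) *~ c (k, l)) =
   (fun n => ((1 *~ c (k, l)) * (Um ^+ l) ^+ n) *+ n ^ k).
  apply/funext => n; rewrite -exprM mulnC mulrzl.
  by rewrite ![_ *+ _]pmulrn -!mulrzA mulrC.
apply: (@poly_like_le _ (k + E)); first by have := ltn_ord k; lia.
apply: poly_like_mulrn_exp.
apply: (@poly_like_exp _ p _ _ (map_mx f V * \sum_(i < l) Um ^+ i)).
  (* [U ^ l] is again 1 modulo [p], by factoring [U ^ l - 1]. *)
  have -> : Um ^+ l = 1 + (Um - 1) * (\sum_(i < l) Um ^+ i) by rewrite -subrX1 addrC subrK.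
  congr (1 + _); rewrite -mulrnAl; congr (_ * _).
  by rewrite /Um defU rmorphD rmorph1 /= addrAC subrr add0r raddfMn.
apply/matrixP => i j; rewrite !mxE mulmxnE.
rewrite -mulr_natr -/m; have -> : (m%:R : 'Z_m) = 0 by rewrite pchar_Zp.
by rewrite mulr0.
Qed.

(** * Evaluation at algebraic points *)

Definition bndmx (h : nat) a b (X : 'M[int]_(a, b)) : Prop :=
  forall i j, (`|X i j| <= h)%N.

Lemma absz_sum (I : Type) (s : seq I) (F : I -> int) (b : I -> nat) :
  (forall i, (`|F i| <= b i)%N) ->
  (absz (\sum_(i <- s) F i)%R <= \sum_(i <- s) b i)%N.
Proof.
move=> hF; elim: s => [|i s IHs]; first by rewrite !big_nil.
rewrite !big_cons; apply: leq_trans (leq_add (hF i) IHs).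
by case: (F i) (\sum_(j <- s) F j)%R => [a|a] [b0|b0]; lia.
Qed.

Lemma bndmx_mul n a b (X Y : 'M[int]_n.+1) :
  bndmx a X -> bndmx b Y -> bndmx (n.+1 * (a * b)) (X * Y).
Proof.
move=> hX hY i j; rewrite mxE.
apply: leq_trans (absz_sum (b := fun=> (a * b)%N) _ _) _.
  by move=> k; rewrite abszM leq_mul.
by rewrite big_const_ord iter_addn_0 mulnC.
Qed.

Lemma bndmx_exp n a (X : 'M[int]_n.+1) k :
  (0 < a)%N -> bndmx a X -> bndmx ((n.+1 * a) ^ k) (X ^+ k).
Proof.
move=> a0 hX; elim: k => [|k IHk].
  by move=> i j; rewrite expr0 mxE; case: (_ == _).
rewrite exprS expnS => i j; apply: leq_trans (bndmx_mul hX IHk i j) _.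
by rewrite mulnA.
Qed.

Lemma dvdz_small (m : nat) (x : int) : (m%:Z %| x)%Z -> (`|x| < m)%N -> x = 0.
Proof.
move=> dx lt_xm; apply/eqP; rewrite -absz_eq0; apply: contraTT lt_xm.
by rewrite -lt0n -leqNgt => /dvdn_leq; apply.
Qed.

Section Evaluation.
Variables (p E d K L Bd R S t H : nat) (A B V : 'M[int]_d.+1) (q q' : int).
Variable c : 'I_K * 'I_L -> int.
Let n0 := (R + t * S)%N.
Let Q := ((R + S) * L)%N.
Hypotheses (p1 : (1 < p)%N) (E0 : (0 < E)%N).
Hypothesis qq' : ((p ^ E)%N%:Z %| q * q' - 1)%Z.
Hypothesis congAB : dvdmx (p ^ E) (q' *: B - (q' *: A) ^+ t).
Hypothesis c_small : forall i, (`|c i| < Bd)%N.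
Hypothesis c_van : forall n, dvdmx (p ^ E)
  (\sum_(i : 'I_K * 'I_L) (q' *: A) ^+ (n * i.2) *~ (c i * (n ^ i.1)%:Z)).
Hypotheses (h0 : nat) (h00 : (0 < h0)%N) (H_def : H = (d.+1 * h0)%N).
Hypotheses (bndA : bndmx h0 A) (bndB : bndmx h0 B) (bndq : (`|q| <= H)%N).
Hypothesis small : (K * L * (Bd * n0 ^ K * H ^ Q.+1) < p ^ E)%N.

Definition eval_mx (r s : nat) : 'M[int]_d.+1 :=
  \sum_(i : 'I_K * 'I_L)
    (c i * ((r + t * s) ^ i.1)%:Z * q ^+ (Q - (r + s) * i.2)) *:
      (A ^+ (r * i.2) * B ^+ (s * i.2)).

(** An integer that is divisible by [p ^ E] and smaller than [p ^ E] is zero.  Here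
    divisibility comes from the congruence of [B / q] with the [t]-th power of [A / q], which
    identifies the value at the algebraic point with the value of the auxiliary function at
    [n = r + t * s]; the power of [q] clears denominators. *)
Lemma eval_mx_eq0 r s : (r < R)%N -> (s < S)%N -> eval_mx r s = 0.
Proof.
move=> ltr lts; have m1 : (1 < p ^ E)%N by rewrite -(exp1n E) ltn_exp2r.
have leQ (l : 'I_L) : ((r + s) * l <= Q)%N.
  by rewrite leq_mul //; [lia | exact/ltnW].
have div : dvdmx (p ^ E) (eval_mx r s).
  apply/map_mx_Zp_eq0 => //.
  set f : {rmorphism int -> 'Z_(p ^ E)} := intr.
  set U := map_mx f (q' *: A).
  have fqq : f q * f q' = 1.
    by apply/eqP; rewrite -subr_eq0 -(rmorph1 f) -rmorphM -rmorphB intr_Zp_eq0.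
  have fA : map_mx f A = f q *: U.
    by rewrite /U map_mxZ scalerA fqq scale1r.
  have fB : map_mx f B = f q *: U ^+ t.
    have : map_mx f (q' *: B - (q' *: A) ^+ t) = 0 by apply/map_mx_Zp_eq0.
    rewrite rmorphB /= rmorphXn /= map_mxZ -/U => /eqP; rewrite subr_eq0 => /eqP <-.
    by rewrite scalerA fqq scale1r.
  have van : map_mx f (\sum_(i : 'I_K * 'I_L)
      (q' *: A) ^+ ((r + t * s) * i.2) *~ (c i * ((r + t * s) ^ i.1)%:Z)) = 0.
    exact/map_mx_Zp_eq0.
  transitivity (f q ^+ Q *: map_mx f (\sum_(i : 'I_K * 'I_L)
      (q' *: A) ^+ ((r + t * s) * i.2) *~ (c i * ((r + t * s) ^ i.1)%:Z))); last first.
    by rewrite van scaler0.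
  rewrite !raddf_sum /=; apply: eq_bigr => i _.
  rewrite map_mxZ !rmorphM /= !rmorphXn /= fA fB raddfMz /= rmorphXn /= -/U.
  rewrite !exprZn -scalerAl -scalerAr !scalerA -exprM -exprD.
  rewrite -scaler_int scalerA; congr (_ *: _); last by congr (_ ^+ _); lia.
  rewrite !rmorphM /= rmorphXn /=.
  rewrite -{2}(subnK (leQ i.2)) exprD mulnDl exprD; ring.
apply/matrixP => i j; rewrite [RHS]mxE; apply: dvdz_small (div i j) _.
apply: leq_ltn_trans small; rewrite summxE.
have n00 : (0 < n0)%N by rewrite /n0; lia.
have H0 : (0 < H)%N by rewrite H_def muln_gt0.
apply: leq_trans (absz_sum (b := fun=> (Bd * n0 ^ K * H ^ Q.+1)%N) _ _) _; last first.
  by rewrite big_const card_prod !card_ord iter_addn_0 mulnC.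
move=> k; rewrite mxE !abszM !abszX -!mulnA.
apply: leq_mul; first exact: ltnW.
apply: leq_mul.
  apply: (@leq_trans (n0 ^ k.1)).
    by case: (nat_of_ord k.1) => [|a] //=; rewrite leq_exp2r // /n0 leq_add ?leq_mul // ltnW.
  by rewrite leq_pexp2l // ltnW.
have -> : Q.+1 = ((Q - (r + s) * k.2) + (1 + (r * k.2 + s * k.2)))%N.
  by have := leQ k.2; lia.
rewrite expnD; apply: leq_mul.
  by case: (_ - _)%N => [|a] //; rewrite leq_exp2r.
have := bndmx_mul (bndmx_exp (r * k.2) h00 bndA) (bndmx_exp (s * k.2) h00 bndB) i j.
move/leq_trans; apply; rewrite -H_def !expnD expn1 leq_mul // H_def.
by rewrite leq_pmulr.
Qed.

Lemma eval_eigen (F : numFieldType) (w : 'rV[F]_d.+1) (al be : F) r s :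
  q != 0 -> w != 0 -> w *m map_mx intr A = al *: w -> w *m map_mx intr B = be *: w ->
  (r < R)%N -> (s < S)%N ->
  \sum_(i : 'I_K * 'I_L) (c i)%:~R * (r + t * s)%:R ^+ i.1 *
     ((al / q%:~R) ^+ r * (be / q%:~R) ^+ s) ^+ i.2 = 0.
Proof.
move=> q0 w0 wA wB ltr lts.
have qF0 : (q%:~R : F) != 0 by rewrite intr_eq0.
have leQ (l : 'I_L) : ((r + s) * l <= Q)%N.
  by rewrite leq_mul //; [lia | exact/ltnW].
have wX (X : 'M[int]_d.+1) (x : F) k : w *m map_mx intr X = x *: w ->
    w *m map_mx intr (X ^+ k) = x ^+ k *: w.
  move=> wX; elim: k => [|k IHk].
    by rewrite !expr0 map_mx1 mulmx1 scale1r.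
  by rewrite exprS map_mxM mulmxA wX -scalemxAl IHk scalerA exprS.
have := congr1 (fun X => w *m map_mx intr X) (eval_mx_eq0 ltr lts).
rewrite map_mx0 mulmx0 raddf_sum /= mulmx_sumr.
rewrite [X in X = _](eq_bigr (fun i : 'I_K * 'I_L =>
    ((c i * ((r + t * s) ^ i.1)%:Z * q ^+ (Q - (r + s) * i.2))%:~R *
      (al ^+ (r * i.2) * be ^+ (s * i.2))) *: w)); last first.
  move=> i _; rewrite map_mxZ map_mxM -scalemxAr mulmxA (wX _ _ _ wA) -scalemxAl.
  by rewrite (wX _ _ _ wB) !scalerA mulrA /=.
move=> sum0; have : (\sum_(i : 'I_K * 'I_L)
    (c i * ((r + t * s) ^ i.1)%:Z * q ^+ (Q - (r + s) * i.2))%:~R *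
      (al ^+ (r * i.2) * be ^+ (s * i.2))) *: w = 0 by rewrite scaler_suml.
move=> /eqP; rewrite scaler_eq0 (negPf w0) orbF => /eqP e.
apply/(mulfI (expf_neq0 Q qF0)); rewrite mulr0 mulr_sumr -[RHS]e.
apply: eq_bigr => i _.
rewrite !rmorphM /= !rmorphXn /=.
rewrite -{1}(subnK (leQ i.2)) exprD !exprMn !exprVn -!exprM mulnDl exprD.
by field; rewrite !expf_neq0.
Qed.

End Evaluation.

(** The heart of the transcendence argument: auxiliary function, smallness and zero
    estimate are incompatible.  The matrices serve as a model of integers of a number
    field of degree at most [d.+1], [w] selecting an embedding. *)
Lemma no_congruence (p E d K L Bd rho S t h0 : nat)
    (A B V : 'M[int]_d.+1) (q q' : int)
    (F : numFieldType) (w : 'rV[F]_d.+1) (mu eta : F) :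
  (1 < p)%N -> (0 < E)%N ->
  ((p ^ E)%N%:Z %| q * q' - 1)%Z -> q != 0 ->
  q' *: A = 1 + V *+ p ->
  dvdmx (p ^ E) (q' *: B - (q' *: A) ^+ t) ->
  (0 < h0)%N -> bndmx h0 A -> bndmx h0 B -> (`|q| <= d.+1 * h0)%N ->
  w != 0 ->
  w *m map_mx intr A = (q%:~R * mu) *: w ->
  w *m map_mx intr B = (q%:~R * eta) *: w ->
  mu != 0 -> eta != 0 -> (forall n, (0 < n)%N -> mu ^+ n != 1) ->
  (L * K <= rho * S)%N -> (rho <= t)%N ->
  ((p ^ (E * (d.+1 * d.+1))) ^ (K + E) < Bd ^ (K * L))%N ->
  (K * L * (Bd * (L + rho + t * S) ^ K *
     (d.+1 * h0) ^ ((L + rho + S) * L).+1) < p ^ E)%N ->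
  False.
Proof.
move=> p1 E0 qq' q0 defA congAB h00 bA bB bq w0 wA wB mu0 eta0 mu_inf LK rho_t ltB small.
have qF0 : (q%:~R : F) != 0 by rewrite intr_eq0.
have [c [[i0 c0] cB cvan]] := vanishing_combination p1 E0 defA ltB.
pose P (l : 'I_L) : {poly F} := \poly_(k < K) (if insub k is Some k' then (c (k', l))%:~R else 0).
have PE l x : (P l).[x] = \sum_(k < K) (c (k, l))%:~R * x ^+ k.
  by rewrite horner_poly; apply: eq_bigr => k _; rewrite valK.
have P0 : forall l, P l = 0.
  apply: (zero_estimate mu0 eta0 mu_inf _ LK rho_t) => [l|r s ltr lts].
    exact: size_poly.
  have := eval_eigen p1 E0 qq' congAB cB cvan h00 (erefl _) bA bB bq small q0 w0 wA wB ltr lts.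
  rewrite !(mulrC q%:~R) !mulfK // => e; rewrite -[RHS]e.
  under eq_bigr => l _ do rewrite PE mulr_suml.
  by rewrite exchange_big pair_bigA; apply: eq_bigr => -[k l] _ /=.
move/eqP: c0; apply; have := congr1 (fun g : {poly F} => g`_i0.1) (P0 i0.2).
rewrite coef_poly coef0 ltn_ord valK => /eqP; rewrite intr_eq0 => /eqP <-.
by case: (i0).
Qed.

(** * Valuations of rational numbers and matrices *)

(** At zero the value is 0, which is meaningless; see [pge]. *)
Definition vp (p : nat) (x : rat) : int :=
  (logn p `|numq x|%N)%:Z - (logn p `|denq x|%N)%:Z.

(** The valuation of [x] is at least [k], with the convention that zero has infinite
    valuation; working with these half-lines avoids arithmetic with infinity. *)
Definition pge (p : nat) (k : int) (x : rat) : bool := (x == 0) || (k <= vp p x).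

Section Valuation.
Variable p : nat.
Hypothesis p_prime : prime p.
Local Notation vp := (vp p).
Local Notation pge := (pge p).

Lemma vp_frac (a b : int) : a != 0 -> b != 0 ->
  vp (a%:~R / b%:~R) = (logn p `|a|%N)%:Z - (logn p `|b|%N)%:Z.
Proof.
move=> a0 b0; set x := _ / _; rewrite /vp.
have bQ0 : (b%:~R : rat) != 0 by rewrite intr_eq0.
have x0 : x != 0 by rewrite mulf_neq0 ?invr_eq0 ?intr_eq0.
have e : numq x * b = a * denq x.
  apply: (@intr_inj rat); rewrite !rmorphM /= numqE.
  by rewrite mulrAC /x divfK.
have := congr1 (fun z : int => logn p `|z|%N) e.
rewrite /= !abszM !lognM ?absz_gt0 ?numq_eq0 ?denq_neq0 //.
lia.
Qed.

(** Over a common denominator the condition is a divisibility of integers, which is how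
    the ultrametric inequality reduces to the stability of multiples under addition. *)
Lemma pge_frac (a c : int) (k : int) : c != 0 ->
  pge k (a%:~R / c%:~R) <->
  (forall n : nat, n%:Z <= k + (logn p `|c|%N)%:Z -> ((p ^ n)%N%:Z %| a)%Z).
Proof.
move=> c0; have [->|a0] := eqVneq a 0.
  by rewrite mul0r /pge eqxx; split=> // _ n _; rewrite dvdz0.
have aQ0 : (a%:~R : rat) != 0 by rewrite intr_eq0.
rewrite /pge mulf_eq0 invr_eq0 !intr_eq0 (negPf a0) (negPf c0) /= vp_frac //.
have dvdE n : ((p ^ n)%N%:Z %| a)%Z = (n <= logn p `|a|)%N.
  by rewrite dvdzE /= pfactor_dvdn ?absz_gt0.
split=> [h n hn|h]; first by rewrite dvdE; lia.
have [neg|pos] := lerP 0 (k + (logn p `|c|%N)%:Z); last by lia.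
have := h (absz (k + (logn p `|c|%N)%:Z)); rewrite dvdE; lia.
Qed.

Lemma pge_le k l x : k <= l -> pge l x -> pge k x.
Proof. by rewrite /pge => kl /orP[->//|h]; rewrite (le_trans kl h) orbT. Qed.

Lemma pge0 k : pge k 0. Proof. by rewrite /pge eqxx. Qed.

Lemma pgeD k x y : pge k x -> pge k y -> pge k (x + y).
Proof.
set c := denq x * denq y.
have c0 : c != 0 by rewrite mulf_neq0.
have cQ0 : (c%:~R : rat) != 0 by rewrite intr_eq0.
have dx : (denq x)%:~R != 0 :> rat by rewrite intr_eq0 denq_neq0.
have dy : (denq y)%:~R != 0 :> rat by rewrite intr_eq0 denq_neq0.
have ex : x = (numq x * denq y)%:~R / c%:~R.
  by rewrite -{1}[x]divq_num_den /c !rmorphM /=; field; rewrite dx dy.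
have ey : y = (numq y * denq x)%:~R / c%:~R.
  by rewrite -{1}[y]divq_num_den /c !rmorphM /=; field; rewrite dx dy.
move=> hx hy; rewrite ex in hx; rewrite ey in hy.
have -> : x + y = (numq x * denq y + numq y * denq x)%:~R / c%:~R.
  by rewrite (congr2 +%R ex ey) -mulrDl -rmorphD.
apply/pge_frac => // n hn; apply: rpredD.
  exact: (pge_frac _ _ c0).1 hx n hn.
exact: (pge_frac _ _ c0).1 hy n hn.
Qed.

Lemma pgeN k x : pge k (- x) = pge k x.
Proof. by rewrite /pge oppr_eq0 /vp numqN denqN abszN. Qed.

Lemma pgeB k x y : pge k x -> pge k y -> pge k (x - y).
Proof. by move=> hx hy; rewrite pgeD // pgeN. Qed.

Lemma pge_sum k (I : Type) (s : seq I) (F : I -> rat) :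
  (forall i, pge k (F i)) -> pge k (\sum_(i <- s) F i).
Proof. by move=> hF; apply: (big_ind (fun x => pge k x)) => // *; exact: pgeD. Qed.

Lemma vpM (x y : rat) : x != 0 -> y != 0 -> vp (x * y) = vp x + vp y.
Proof.
move=> x0 y0; rewrite -{1}[x]divq_num_den -{1}[y]divq_num_den.
have -> (a b c d : rat) : a / b * (c / d) = (a * c) / (b * d) by rewrite invfM; ring.
rewrite -!rmorphM vp_frac ?mulf_neq0 ?numq_eq0 ?denq_neq0 //.
have nx : (0 < `|numq x|)%N by rewrite absz_gt0 numq_eq0.
have ny : (0 < `|numq y|)%N by rewrite absz_gt0 numq_eq0.
have dx : (0 < `|denq x|)%N by rewrite absz_gt0 denq_neq0.
have dy : (0 < `|denq y|)%N by rewrite absz_gt0 denq_neq0.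
by rewrite /vp !abszM (lognM _ nx ny) (lognM _ dx dy) !PoszD opprD addrACA.
Qed.

Lemma vp1 : vp 1 = 0. Proof. by rewrite /vp logn1. Qed.

Lemma vpX (x : rat) n : x != 0 -> vp (x ^+ n) = vp x *+ n.
Proof.
move=> x0; elim: n => [|n IHn]; first by rewrite vp1.
by rewrite exprS vpM ?expf_neq0 // IHn mulrS.
Qed.

Lemma vpV (x : rat) : x != 0 -> vp x^-1 = - vp x.
Proof.
move=> x0; have := vpM x0 (invr_neq0 x0); rewrite divff // vp1; lia.
Qed.

Lemma pgeM k l x y : pge k x -> pge l y -> pge (k + l) (x * y).
Proof.
rewrite /pge mulf_eq0; have [//|x0 /= hx] := eqVneq x 0.
by have [//|y0 /= hy] := eqVneq y 0; rewrite vpM // lerD.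
Qed.

Lemma pgeMl k x y : pge 0 x -> pge k y -> pge k (x * y).
Proof. by rewrite -{2}[k]add0r; exact: pgeM. Qed.

Lemma pge_vp x k : x != 0 -> pge k x = (k <= vp x).
Proof. by rewrite /pge => /negPf ->. Qed.

Lemma pge_vpx x : pge (vp x) x.
Proof. by rewrite /pge lexx orbT. Qed.

Lemma pge_dvd (k : nat) (n : int) : pge k%:Z n%:~R = ((p ^ k)%N%:Z %| n)%Z.
Proof.
apply/idP/idP => [|h].
  by rewrite -[n%:~R]divr1 => h; apply: (@pge_frac n 1 _ isT).1 h _ _; rewrite logn1; lia.
rewrite -[n%:~R]divr1; apply/(@pge_frac n 1) => // m; rewrite logn1 => hm.
by apply: dvdz_trans h; rewrite dvdzE /= dvdn_exp2l //; lia.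
Qed.

Lemma pge_int (n : int) : pge 0 n%:~R.
Proof. by rewrite (pge_dvd 0) expn0 dvd1z. Qed.

Lemma pge_nat (n : nat) : pge 0 n%:R.
Proof. exact: (pge_int n). Qed.

Definition pgem (a b : nat) (k : int) (X : 'M[rat]_(a, b)) : Prop :=
  forall i j, pge k (X i j).

Lemma pgem_le a b k l (X : 'M[rat]_(a, b)) : k <= l -> pgem l X -> pgem k X.
Proof. by move=> kl hX i j; apply: pge_le kl (hX i j). Qed.

Lemma pgem0 a b k : pgem k (0 : 'M[rat]_(a, b)).
Proof. by move=> i j; rewrite mxE pge0. Qed.

Lemma pgemD a b k (X Y : 'M[rat]_(a, b)) : pgem k X -> pgem k Y -> pgem k (X + Y).
Proof. by move=> hX hY i j; rewrite mxE pgeD. Qed.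

Lemma pgemN a b k (X : 'M[rat]_(a, b)) : pgem k X -> pgem k (- X).
Proof. by move=> hX i j; rewrite mxE pgeN. Qed.

Lemma pgemB a b k (X Y : 'M[rat]_(a, b)) : pgem k X -> pgem k Y -> pgem k (X - Y).
Proof. by move=> hX hY; apply: pgemD => //; exact: pgemN. Qed.

Lemma pgemZ a b k l x (X : 'M[rat]_(a, b)) : pge k x -> pgem l X -> pgem (k + l) (x *: X).
Proof. by move=> hx hX i j; rewrite mxE pgeM. Qed.

Lemma pgem_mul a b c k l (X : 'M[rat]_(a, b)) (Y : 'M[rat]_(b, c)) :
  pgem k X -> pgem l Y -> pgem (k + l) (X *m Y).
Proof. by move=> hX hY i j; rewrite mxE pge_sum // => m; rewrite pgeM. Qed.

(** A nonzero matrix has a valuation, the least one among its entries. *)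
Lemma pgem_max a b (X : 'M[rat]_(a, b)) : X != 0 ->
  exists v : int, forall k, pgem k X <-> k <= v.
Proof.
move=> X0; have [ij0 h0] : exists ij : 'I_a * 'I_b, X ij.1 ij.2 != 0.
  apply/existsP; move: X0; apply: contraR; rewrite negb_exists => /forallP h.
  apply/eqP/matrixP => i j; rewrite mxE; apply/eqP.
  by have := h (i, j); rewrite negbK.
case: (@Order.TotalTheory.arg_minP _ _ _ ij0
  (fun ij => X ij.1 ij.2 != 0) (fun ij => vp (X ij.1 ij.2)) h0) => ij hij hmin.
exists (vp (X ij.1 ij.2)) => k; split=> [/(_ ij.1 ij.2)|h i j].
  by rewrite pge_vp.
have [->|Xij] := eqVneq (X i j) 0; first exact: pge0.
by rewrite pge_vp //; apply: le_trans h (hmin (i, j) Xij).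
Qed.

Lemma pgem_ex a b (X : 'M[rat]_(a, b)) : exists k : int, pgem k X.
Proof.
have [->|/pgem_max[v hv]] := eqVneq X 0; first by exists 0; exact: pgem0.
by exists v; apply/hv.
Qed.

Lemma pgem_neg a b (X : 'M[rat]_(a, b)) : exists C : nat, pgem (- C%:Z) X.
Proof.
have [k hk] := pgem_ex X; exists `|k|%N; apply: pgem_le hk; lia.
Qed.

Lemma pgem1 n : pgem 0 (1%:M : 'M[rat]_n).
Proof. by move=> i j; rewrite mxE pge_nat. Qed.

Lemma padic_val2_pgem (R : realType) (z : 'cV[rat]_2) (v : int) :
  (forall k, pgem k z <-> k <= v) -> padic_val2 R p z = (v%:~R)%:E.
Proof.
move=> hv.
have valE x : x != 0 -> padic_val R p x = ((vp x)%:~R)%:E.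
  by move=> /negPf x0; rewrite /padic_val x0 rmorphB /= -!pmulrn.
have pE k : pgem k z <-> pge k (z 0 0) /\ pge k (z 1 0).
  split=> [h|[h0 h1] i j]; first by split; exact: h.
  rewrite (ord1 j); case: i => [[|[|//]]] lti.
    by rewrite (_ : Ordinal lti = 0) //; exact: val_inj.
  by rewrite (_ : Ordinal lti = 1) //; exact: val_inj.
have H k : (pge k (z 0 0) /\ pge k (z 1 0)) <-> k <= v.
  by rewrite -pE.
rewrite /padic_val2 /mine; have [z0|z0] := eqVneq (z 0 0) 0; have [z1|z1] := eqVneq (z 1 0) 0.
- have := (H (v + 1)).1; rewrite z0 z1 !pge0 => /(_ (conj isT isT)); lia.
- rewrite z0 {1}/padic_val eqxx; have -> : (+oo < padic_val R p (z 1%R 0%R))%E = false.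
    by rewrite valE.
  rewrite valE //; congr (_%:~R)%:E.
  have := (H (vp (z 1 0))).1; have := (H v).2 (lexx v); rewrite z0 !pge0 !pge_vp //.
  by move=> [_ h1] /(_ (conj isT (lexx _))) h2; apply/eqP; rewrite eq_le h1 h2.
- rewrite z1 {1}/padic_val (negPf z0) {1}/padic_val eqxx ltry.
  rewrite valE //; congr (_%:~R)%:E.
  have := (H (vp (z 0 0))).1; have := (H v).2 (lexx v); rewrite z1 !pge0 !pge_vp //.
  by move=> [h1 _] /(_ (conj (lexx _) isT)) h2; apply/eqP; rewrite eq_le h1 h2.
- rewrite !valE // lte_fin ltr_int.
  have := (H (vp (z 0 0))).1; have := (H (vp (z 1 0))).1; have := (H v).2 (lexx v).
  rewrite !pge_vp // => -[h0 h1] h2 h3; case: ltP => h; congr (_%:~R)%:E.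
    by have := h3 (conj (lexx _) (ltW h)); lia.
  by have := h2 (conj h (lexx _)); lia.
Qed.

End Valuation.

(** * Powers are not exponentially close to a fixed number *)

Lemma clear_denominators (p a b : nat) (X : 'M[rat]_(a, b)) :
  prime p -> pgem p 0 X ->
  exists2 q : nat, (0 < q)%N && coprime p q &
    exists Y : 'M[int]_(a, b), map_mx intr Y = q%:R *: X.
Proof.
move=> p_prime hX.
pose q := (\prod_(ij : 'I_a * 'I_b) `|denq (X ij.1 ij.2)|)%N.
have den_coprime x : pge p 0 x -> coprime p `|denq x|.
  rewrite /pge => /orP[/eqP->|]; first by rewrite coprimen1.
  rewrite /vp => h; rewrite prime_coprime //; apply/negP => pd.
  have : (0 < logn p `|denq x|)%N by rewrite logn_gt0 mem_primes p_prime absz_gt0 denq_neq0.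
  have pn : ~~ (p %| `|numq x|)%N.
    apply/negP => pn; have := coprime_num_den x.
    rewrite /coprime => /eqP g; have : (p %| gcdn `|numq x| `|denq x|)%N by rewrite dvdn_gcd pn pd.
    by rewrite g Euclid_dvd1.
  have : logn p `|numq x| = 0%N by rewrite lognE (negPf pn) !andbF.
  lia.
exists q.
  apply/andP; split; first by apply: prodn_gt0 => ij; rewrite absz_gt0 denq_neq0.
  rewrite /q; elim/big_ind: _ => [|x y hx hy|ij _]; first exact: coprimen1.
    by rewrite coprimeMr hx.
  exact/den_coprime/hX.
exists (\matrix_(i, j) numq (q%:R * X i j)); apply/matrixP => i j; rewrite !mxE.
have den (x : rat) : x = (numq x)%:~R / (`|denq x|%N)%:R.
  by rewrite -{1}[x]divq_num_den pmulrn absz_denq.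
have : exists n : int, q%:R * X i j = n%:~R.
  have /dvdnP[m hm] : (`|denq (X i j)| %| q)%N.
    by rewrite /q (bigD1 (i, j)) //= dvdn_mulr.
  exists (m%:Z * numq (X i j)); rewrite hm natrM {2}(den (X i j)) rmorphM /= -pmulrn.
  by field; rewrite pnatr_eq0 absz_eq0 denq_neq0.
by move=> [n ->]; rewrite numq_int.
Qed.

(** The group of invertible matrices over a finite field is finite, so one exponent
    brings all p-adic units into the region where powers are p-adically analytic. *)
Lemma unit_power (p d : nat) : prime p ->
  exists2 g, (0 < g)%N & forall X : 'M[int]_d.+1, ~~ (p%:Z %| \det X)%Z ->
    exists V : 'M[int]_d.+1, X ^+ g = 1 + V *+ p.
Proof.
move=> p_prime; have p1 := prime_gt1 p_prime.
pose G := setT_group {unit 'M['F_p]_d.+1}; pose g := #|G|.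
exists g; first exact: cardG_gt0.
move=> X hX.
pose f : {rmorphism int -> 'F_p} := intr.
have detX : map_mx f X \is a GRing.unit.
  have -> : (map_mx f X \is a GRing.unit) = (map_mx f X \in unitmx) by [].
  rewrite unitmxE det_map_mx unitfE.
  by apply: contra hX; rewrite /f /= (@intr_Zp_eq0 (pdiv p)) pdiv_id.
have Xg : map_mx f X ^+ g = 1.
  have uG : FinRing.unit _ detX \in G by rewrite inE.
  have := expg_cardG uG.
  by move=> /(congr1 val); rewrite FinRing.val_unitX.
have : dvdmx p (X ^+ g - 1).
  rewrite -{1}(pdiv_id p_prime); apply/map_mx_Zp_eq0; first by rewrite pdiv_id.
  by rewrite rmorphB rmorph1 rmorphXn /= [X in X - 1]Xg subrr.
move=> hd; exists (\matrix_(i, j) ((X ^+ g - 1) i j %/ p)%Z).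
apply/eqP; rewrite addrC -subr_eq; apply/eqP/matrixP => i j.
rewrite mulmxnE [X in _ = X *+ _]mxE -mulr_natr natz; symmetry; exact: divzK (hd i j).
Qed.

Lemma bndmx_ex a b (X : 'M[int]_(a, b)) : exists h : nat, bndmx h X.
Proof.
exists (\sum_i \sum_j `|X i j|)%N => i j.
by rewrite (bigD1 i) //= (bigD1 j) //= -addnA leq_addr.
Qed.

Lemma bndmx_le a b h h' (X : 'M[int]_(a, b)) : (h <= h')%N -> bndmx h X -> bndmx h' X.
Proof. by move=> hh hX i j; apply: leq_trans (hX i j) hh. Qed.

Lemma mod_inverse (m q : nat) : (0 < q)%N -> coprime m q -> exists q', (m%:Z %| q%:Z * q' - 1)%Z.
Proof.
move=> q0; rewrite coprime_sym => cop.
have [u v e _] := egcdnP m q0.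
exists u%:Z; rewrite -PoszM mulnC e; move: cop; rewrite /coprime => /eqP ->.
by rewrite PoszD addrK PoszM dvdz_mull.
Qed.

Lemma eigen_exp (F : fieldType) d (w : 'rV[F]_d.+1) (X : 'M[F]_d.+1) x k :
  w *m X = x *: w -> w *m (X ^+ k) = x ^+ k *: w.
Proof.
move=> wX; elim: k => [|k IHk].
  by rewrite !expr0 mulmx1 scale1r.
by rewrite exprS -[X * _]/(X *m _) mulmxA wX -scalemxAl IHk scalerA exprS.
Qed.

(** A fixed [N] cannot be p-adically approximated by [M ^ t] exponentially well in [t]: the
    agreement is [o(t)] digits.  This is the case needed here of the lower
    bounds for linear forms in two p-adic logarithms.  The eigenvector hypotheses say that
    [M] and [N] represent algebraic numbers [mu] and [eta]; the bound can fail if [mu] is a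
    root of unity, since then the powers return to the same value forever. *)
Lemma power_not_close (p d e : nat) (M N : 'M[rat]_d.+1)
    (w : 'rV[algC]_d.+1) (mu eta : algC) :
  prime p -> pgem p 0 M -> pgem p 0 N -> \det M != 0 -> vp p (\det M) = 0 ->
  w != 0 -> w *m map_mx ratr M = mu *: w -> w *m map_mx ratr N = eta *: w ->
  mu != 0 -> eta != 0 -> (forall n, (0 < n)%N -> mu ^+ n != 1) ->
  exists t0, forall t k : nat, (t0 <= t)%N -> pgem p k%:Z (M ^+ t - N) ->
    (e * k <= t)%N.
Proof.
move=> p_prime pM pN detM0 detM w0 wM wN mu0 eta0 mu_inf.
have p1 := prime_gt1 p_prime.
have [q1 /andP[q10 cop1] [A1 hA1]] := clear_denominators p_prime pM.
have [q2 /andP[q20 cop2] [B1 hB1]] := clear_denominators p_prime pN.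
pose q0 := (q1 * q2)%N; pose A0 := q2%:Z *: A1; pose B0 := q1%:Z *: B1.
have q00 : (0 < q0)%N by rewrite muln_gt0 q10.
have copq : coprime p q0 by rewrite coprimeMr cop1.
have hA0 : map_mx (intr : int -> rat) A0 = q0%:R *: M.
  by rewrite map_mxZ /= hA1 scalerA /q0 natrM mulrC pmulrn.
have hB0 : map_mx (intr : int -> rat) B0 = q0%:R *: N.
  by rewrite map_mxZ /= hB1 scalerA /q0 natrM pmulrn.
clearbody q0 A0 B0; clear A1 B1 hA1 hB1 q1 q2 q10 q20 cop1 cop2.
have [g g0 unitp] := unit_power d p_prime.
(* All data are replaced by their [g]-th powers, so that the residue of [M] becomes 1. *)
have [hA bA] := bndmx_ex (A0 ^+ g); have [hB bB] := bndmx_ex (B0 ^+ g).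
pose h0 := (hA + hB + q0 ^ g).+1.
have [t0 ht0] := parameters d e p1 (ltn0Sn _ : 0 < h0)%N.
exists t0 => t k let0 hk; rewrite leqNgt; apply/negP => lt_t.
have [E [K [L [Bd [rho [S [[E0 eE] hLK hrho hpig hsmall]]]]]]] := ht0 t let0.
have leEk : (E <= k)%N by have := leq_ltn_trans eE lt_t; rewrite ltn_mul2l => /andP[_ /ltnW].
have m1 : (1 < p ^ E)%N by rewrite -(exp1n E) ltn_exp2r.
have copE : coprime (p ^ E) q0 by rewrite coprimeXl.
have [q' hq'] := mod_inverse q00 copE.
pose f : {rmorphism int -> 'Z_(p ^ E)} := intr.
have fqq : f q0%:Z * f q' = 1.
  by apply/eqP; rewrite -subr_eq0 -(rmorph1 f) -rmorphM -rmorphB intr_Zp_eq0.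
have detA0 : ~~ (p%:Z %| \det A0)%Z.
  have e1 : (\det A0)%:~R = q0%:R ^+ d.+1 * \det M :> rat.
    by rewrite -(det_map_mx intr) hA0 detZ.
  have q0Q : (q0%:R : rat) != 0 by rewrite pnatr_eq0 -lt0n.
  have v1 : vp p (\det A0)%:~R = 0.
    rewrite e1 vpM ?expf_neq0 // detM addr0 vpX //.
    rewrite -[q0%:R]/(q0%:Z%:~R) /vp numq_int denq_int logn1 subr0 /=.
    by rewrite logn_coprime // mul0rn.
  apply/negP; have := pge_dvd p_prime 1 (\det A0); rewrite expn1 => <-.
  by rewrite pge_vp ?v1 // e1 mulf_neq0 ?expf_neq0.
have [V hV] : exists V, (q' *: A0) ^+ g = 1 + V *+ p.
  apply: unitp; rewrite detZ; apply/negP.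
  have pE : (p%:Z %| (p ^ E)%N%:Z)%Z by rewrite dvdzE /= -{1}(expn1 p) dvdn_exp2l.
  have pq' : ~~ (p%:Z %| q')%Z.
    apply/negP => pq'; have := rpredB (dvdz_mull q0%:Z pq') (dvdz_trans pE hq').
    by rewrite opprB addrC subrK dvdzE /= Euclid_dvd1.
  rewrite !dvdzE abszM Euclid_dvdM // abszX Euclid_dvdX // andbT.
  by move: detA0 pq'; rewrite !dvdzE => /negPf -> /negPf ->.
have hcong : dvdmx (p ^ E) (q' ^+ g *: B0 ^+ g - (q' ^+ g *: A0 ^+ g) ^+ t).
  have d1 : dvdmx (p ^ E) (q0%:Z *: A0 ^+ t - q0%:Z ^+ t *: B0).
    have e2 : map_mx (intr : int -> rat) (q0%:Z *: A0 ^+ t - q0%:Z ^+ t *: B0) =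
        q0%:R ^+ t.+1 *: (M ^+ t - N).
      rewrite map_mxB !map_mxZ rmorphXn /= rmorphXn /= hA0 hB0 exprZn !scalerA.
      by rewrite -exprS -exprSr -scalerBr.
    move=> i j; rewrite -pge_dvd //.
    have := congr1 (fun Z : 'M[rat]_d.+1 => Z i j) e2; rewrite mxE => ->.
    rewrite mxE pgeMl //; first by rewrite -natrX pge_nat.
    by apply: pge_le (hk i j); rewrite lez_nat.
  apply/map_mx_Zp_eq0 => //; rewrite -/f.
  have /(map_mx_Zp_eq0 _ m1) := d1; rewrite -/f rmorphB /= !map_mxZ !rmorphXn /= => /eqP.
  rewrite subr_eq0 => /eqP d2.
  rewrite rmorphB /= [X in _ - X]rmorphXn /= !map_mxZ !rmorphXn /=.
  rewrite -!exprZn -exprM mulnC exprM; apply/eqP; rewrite subr_eq0; apply/eqP; congr (_ ^+ g).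
  have := congr1 (fun Z => f q' ^+ t.+1 *: Z) d2; rewrite !scalerA.
  have -> : f q' ^+ t.+1 * f q0%:Z = f q' ^+ t by rewrite exprSr -mulrA [f q' * _]mulrC fqq mulr1.
  have -> : f q' ^+ t.+1 * f q0%:Z ^+ t = f q'.
    by rewrite exprS -mulrA -exprMn [f q' * f _]mulrC fqq expr1n mulr1.
  by move=> <-; rewrite exprZn.
have wA : w *m map_mx intr (A0 ^+ g) = ((q0%:Z ^+ g)%:~R * mu ^+ g) *: w.
  rewrite rmorphXn /= rmorphXn /= -exprMn; apply: eigen_exp.
  have -> : map_mx (intr : int -> algC) A0 = map_mx ratr (map_mx (intr : int -> rat) A0).
    by apply/matrixP => i j; rewrite !mxE ratr_int.
  by rewrite hA0 map_mxZ /= ratr_nat -scalemxAr wM scalerA.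
have wB : w *m map_mx intr (B0 ^+ g) = ((q0%:Z ^+ g)%:~R * eta ^+ g) *: w.
  rewrite rmorphXn /= rmorphXn /= -exprMn; apply: eigen_exp.
  have -> : map_mx (intr : int -> algC) B0 = map_mx ratr (map_mx (intr : int -> rat) B0).
    by apply/matrixP => i j; rewrite !mxE ratr_int.
  by rewrite hB0 map_mxZ /= ratr_nat -scalemxAr wN scalerA.
apply: (@no_congruence p E d K L Bd rho S t h0 (A0 ^+ g) (B0 ^+ g) V (q0%:Z ^+ g) (q' ^+ g)
   _ w (mu ^+ g) (eta ^+ g)) => //.
- rewrite -(intr_Zp_eq0 _ m1) rmorphB rmorphM !rmorphXn /= -/f.
  by rewrite -exprMn fqq expr1n rmorph1 subrr.
- by rewrite expf_neq0 // eqz_nat -lt0n.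
- by rewrite -exprZn.
- by apply: bndmx_le bA; rewrite /h0 -addnA; exact/leqW/leq_addr.
- by apply: bndmx_le bB; rewrite /h0 addnAC; exact/leqW/leq_addl.
- by rewrite abszX /= /h0; apply: (@leq_trans h0); [exact/leqW/leq_addl|rewrite leq_pmull].
- by rewrite expf_neq0.
- by rewrite expf_neq0.
- by move=> n n0; rewrite -exprM mu_inf // muln_gt0 g0.
Qed.

(** * Linear orbits in the plane *)

Lemma ord2P (P : 'I_2 -> Prop) : P 0 -> P 1 -> forall i, P i.
Proof.
move=> P0 P1 [[|[|//]]] lti.
  by rewrite (_ : Ordinal lti = 0) //; exact: val_inj.
by rewrite (_ : Ordinal lti = 1) //; exact: val_inj.
Qed.

Lemma sum2 (V : nmodType) (F : 'I_2 -> V) : \sum_i F i = F 0 + F 1.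
Proof.
rewrite !big_ord_recl big_ord0 addr0; congr (F _ + F _); exact: val_inj.
Qed.

Lemma mulmx2E (R : pzRingType) m n (A : 'M[R]_(m, 2)) (B : 'M[R]_(2, n)) i j :
  (A *m B) i j = A i 0 * B 0 j + A i 1 * B 1 j.
Proof. by rewrite mxE sum2. Qed.

Lemma col2P (R : Type) (u v : 'cV[R]_2) : u 0 0 = v 0 0 -> u 1 0 = v 1 0 -> u = v.
Proof. by move=> h0 h1; apply/colP; apply: ord2P. Qed.

Lemma mx2P (R : Type) (u v : 'M[R]_2) :
  u 0 0 = v 0 0 -> u 0 1 = v 0 1 -> u 1 0 = v 1 0 -> u 1 1 = v 1 1 -> u = v.
Proof. by move=> *; apply/matrixP; apply: ord2P; apply: ord2P. Qed.

Section TwoByTwo.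
Variable R : comNzRingType.
Implicit Types (M : 'M[R]_2) (u v : 'cV[R]_2).

Lemma tr2 M : \tr M = M 0 0 + M 1 1.
Proof. exact: sum2. Qed.

Lemma det2 M : \det M = M 0 0 * M 1 1 - M 0 1 * M 1 0.
Proof.
rewrite (expand_det_row _ 0) sum2 /cofactor !det_mx11 !mxE /= expr0 expr1.
have -> : lift 0 0 = 1 :> 'I_2 by exact: val_inj.
have -> : lift 1 0 = 0 :> 'I_2 by exact: val_inj.
by rewrite mul1r mulN1r mulrN.
Qed.

Lemma cayley2 M : M *m M = \tr M *: M - (\det M)%:M.
Proof.
by apply: mx2P; rewrite mulmx2E !mxE tr2 det2 /= ?mulr1n ?mulr0n; ring.
Qed.

(** The determinant of the matrix with columns [u] and [v]. *)
Definition cross u v : R := u 0 0 * v 1 0 - u 1 0 * v 0 0.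

Lemma cross_mulmx M u v : cross (M *m u) (M *m v) = \det M * cross u v.
Proof. by rewrite /cross !mulmx2E det2; ring. Qed.

Lemma crossDl u v w : cross (u + v) w = cross u w + cross v w.
Proof. by rewrite /cross !mxE; ring. Qed.

Lemma crossDr u v w : cross u (v + w) = cross u v + cross u w.
Proof. by rewrite /cross !mxE; ring. Qed.

Lemma crossNl u v : cross (- u) v = - cross u v.
Proof. by rewrite /cross !mxE; ring. Qed.

Lemma crossNr u v : cross u (- v) = - cross u v.
Proof. by rewrite /cross !mxE; ring. Qed.

Lemma exp_mulmx_recurrence n M (u : 'M[R]_(2, n)) t :
  M ^+ t.+2 *m u = \tr M *: (M ^+ t.+1 *m u) - \det M *: (M ^+ t *m u).
Proof.
rewrite !exprSr -[M ^+ t * M * M]mulrA -[M * M]/(M *m M) cayley2.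
rewrite mulrBr mulmxBl -!scalerAr -scalemxAl -scalemx1.
by rewrite -[M ^+ t * (_ *: _)]/(M ^+ t *m (_ *: 1%:M)) -scalemxAr mulmx1 -scalemxAl.
Qed.

Lemma expS_mulmx M u t : M ^+ t.+1 *m u = M *m (M ^+ t *m u).
Proof. by rewrite exprS mulmxA. Qed.

End TwoByTwo.

Section Linear.
Variables (p : nat) (p_prime : prime p).
Local Notation vp := (vp p).
Local Notation pge := (pge p).
Local Notation pgem := (pgem p).

Lemma pge_cross k l (u v : 'cV[rat]_2) : pgem k u -> pgem l v -> pge (k + l) (cross u v).
Proof.
move=> hu hv; rewrite /cross; apply: pgeB => //; first exact: pgeM.
by apply: pgeM.
Qed.

(** The recurrence of Cayley and Hamilton propagates the bound [a / 2] per step, half of the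
    smaller of twice the valuation of the trace and the valuation of the determinant;
    doubling everything keeps the statement within the integers. *)
Lemma pow_lower (M : 'M[rat]_2) (a : int) :
  (\tr M = 0 \/ a <= 2 * vp (\tr M)) -> (\det M = 0 \/ a <= vp (\det M)) ->
  exists C : nat, forall (t : nat) (k : int), 2 * k + C%:Z <= t%:Z * a -> pgem k (M ^+ t).
Proof.
move=> hT hD; have [C1 hC1] := pgem_neg p_prime M.
have pD (k l : int) (X : 'M[rat]_2) : pgem l X -> k - l <= a -> pgem k (\det M *: X).
  move=> hX kl; case: hD => [->|hD]; first by rewrite scale0r; exact: pgem0.
  by rewrite -(subrK l k); apply: pgemZ => //; apply: pge_le (pge_vpx p _); lia.
exists (2 * C1 + `|a|)%N => t; pose P (t : nat) := forall k : int,
  2 * k + (2 * C1 + `|a|)%N%:Z <= t%:Z * a -> pgem k (M ^+ t).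
suff : P t /\ P t.+1 by case.
elim: t => [|t [IH0 IH1]].
  split=> k hk; first by rewrite expr0; apply: pgem_le (@pgem1 p p_prime 2); lia.
  by rewrite expr1; apply: pgem_le hC1; lia.
split=> // k hk.
have := exp_mulmx_recurrence M 1%:M t; rewrite !mulmx1 => ->.
apply: pgemB => //; last first.
  by apply: (pD _ (k - a)); [apply: IH0; lia|lia].
have [->|T0] := eqVneq (\tr M) 0; first by rewrite scale0r; exact: pgem0.
have {}hT : a <= 2 * vp (\tr M) by case: hT => // h0; rewrite h0 eqxx in T0.
rewrite -[k](subrK (vp (\tr M))) addrC; apply: pgemZ => //; first exact: pge_vpx.
by apply: IH1; lia.
Qed.

(** The adjugate [tr M - M] plays the role of the inverse and has the same trace and
    determinant as [M], so that growth bounds for [M] apply to it unchanged. *)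
Lemma adj2_pow (M : 'M[rat]_2) t :
  ((\tr M)%:M - M) ^+ t *m M ^+ t = ((\det M) ^+ t)%:M.
Proof.
have NM : ((\tr M)%:M - M) *m M = (\det M)%:M.
  by rewrite mulmxBl cayley2 mul_scalar_mx opprB addrC subrK.
elim: t => [|t IHt]; first by rewrite !expr0 mulmx1.
rewrite exprSr exprS -[_ * ((\tr M)%:M - M)]/(_ *m _) -[M * _]/(M *m _).
rewrite mulmxA -(mulmxA _ _ M) NM mul_mx_scalar -scalemxAl IHt.
by rewrite scale_scalar_mx -exprS.
Qed.

(** When the valuation of the determinant is the smaller quantity, both eigenvalues have
    the same valuation: applying the lower bound to the powers of the adjugate undoes [M ^ t]. *)
Lemma pow_upper (M : 'M[rat]_2) (a : int) (y : 'cV[rat]_2) :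
  (\tr M = 0 \/ a <= 2 * vp (\tr M)) -> \det M != 0 -> a = vp (\det M) -> y != 0 ->
  exists C : nat, forall (t : nat) (k : int), pgem k (M ^+ t *m y) -> 2 * k <= t%:Z * a + C%:Z.
Proof.
move=> hT D0 aD y0; pose N := (\tr M)%:M - M.
have trN : \tr N = \tr M by rewrite !tr2 !mxE /= !mulr1n tr2; ring.
have detN : \det N = \det M by rewrite !det2 !mxE /= !mulr1n !mulr0n tr2; ring.
have [||C hC] := @pow_lower N a; first by rewrite trN.
  by right; rewrite detN aD.
have [v hv] := pgem_max p y0.
exists (2 * `|v| + C + 1)%N => t k hk.
have [k' [hk1 hk2]] : exists k', 2 * k' + C%:Z <= t%:Z * a /\ t%:Z * a <= 2 * k' + C%:Z + 1.
  by exists ((t%:Z * a - C%:Z) %/ 2)%Z; lia.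
have := pgem_mul p_prime (hC t k' hk1) hk.
rewrite mulmxA adj2_pow mul_scalar_mx => h.
have DV : (\det M ^+ t)^-1 != 0 by rewrite invr_eq0 expf_neq0.
have := pgemZ p_prime (pge_vpx p (\det M ^+ t)^-1) h.
rewrite scalerA mulVf ?expf_neq0 // scale1r => /hv.
rewrite vpV ?expf_neq0 // vpX // -aD -mulr_natr natz; lia.
Qed.

End Linear.

Section Exceptional.
Variables (p : nat) (p_prime : prime p).
Local Notation vp := (vp p).
Local Notation pge := (pge p).
Local Notation pgem := (pgem p).

Lemma exp_mulmx_eq0 (M : 'M[rat]_2) t (y : 'cV[rat]_2) :
  \det M != 0 -> (M ^+ t *m y == 0) = (y == 0).
Proof.
move=> D0; apply/eqP/eqP => [h|->]; last by rewrite mulmx0.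
have := congr1 (mulmx (((\tr M)%:M - M) ^+ t)) h.
rewrite mulmxA adj2_pow mulmx0 mul_scalar_mx => /eqP.
by rewrite scaler_eq0 expf_eq0 (negPf D0) andbF => /eqP.
Qed.

(** The growth of orbits in the eigenline of the p-adically smaller eigenvalue, whose
    valuation is that of the determinant minus that of the trace; this eigenline need not be
    rational, which is why it is described by the growth. *)
Definition fast_decay (M : 'M[rat]_2) (y : 'cV[rat]_2) : Prop :=
  exists C : nat, forall t : nat,
    pgem (t%:Z * (vp (\det M) - vp (\tr M)) - C%:Z) (M ^+ t *m y).

(** Once the valuation increases by less than that of the smaller eigenvalue, the trace
    term dominates the recurrence strictly, and from then on every step adds exactly the
    valuation of the trace. *)
Lemma decay_dichotomy (M : 'M[rat]_2) (y : 'cV[rat]_2) :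
  \tr M != 0 -> \det M != 0 -> 2 * vp (\tr M) < vp (\det M) -> ~ fast_decay M y ->
  exists C t0 : nat, forall (t : nat) (k : int), (t0 <= t)%N ->
    pgem k (M ^+ t *m y) -> 2 * k <= t%:Z * (2 * vp (\tr M)) + C%:Z.
Proof.
move=> T0 D0; set T := vp (\tr M); set D := vp (\det M) => ltTD slow.
have y0 : y != 0.
  by apply: contra_not_neq slow => ->; exists 0%N => t; rewrite mulmx0; exact: pgem0.
have [v hv] : {v : nat -> int & forall t k, pgem k (M ^+ t *m y) <-> k <= v t}.
  apply: (@choice nat int (fun t v => forall k, pgem k (M ^+ t *m y) <-> k <= v)) => t.
  by apply: pgem_max; rewrite exp_mulmx_eq0.
have [all|/existsNP[t0 ht0]] := pselect (forall t, v t + (D - T) <= v t.+1).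
  case: slow; exists `|v 0%N|%N => t; apply/hv; rewrite -/T -/D.
  elim: t => [|t IHt]; first by lia.
  by have := all t; lia.
have {}ht0 : v t0.+1 < v t0 + (D - T) by rewrite ltNge; apply/negP.
(* One dominated step: the determinant term is strictly smaller, hence negligible. *)
have step j : v j.+1 < v j + (D - T) -> v j.+2 = v j.+1 + T.
  move=> hj; apply/eqP; rewrite eq_le; apply/andP; split; last first.
    apply/hv; rewrite exp_mulmx_recurrence; apply: pgemB => //.
      by rewrite addrC; apply: pgemZ => //; [exact: pge_vpx|exact/hv].
    rewrite -(subrK D (v j.+1 + T)) addrC; apply: pgemZ => //; first exact: pge_vpx.
    by apply/hv; lia.
  rewrite leNgt; apply/negP => hlt.
  have h1 : pgem (v j.+1 + T + 1) (M ^+ j.+2 *m y) by apply/hv; lia.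
  have h2 : pgem (v j.+1 + T + 1) (\det M *: (M ^+ j *m y)).
    rewrite -(subrK D (v j.+1 + T + 1)) addrC; apply: pgemZ => //; first exact: pge_vpx.
    by apply/hv; lia.
  have h3 := pgemD p_prime h1 h2.
  rewrite exp_mulmx_recurrence subrK in h3.
  have := pgemZ p_prime (pge_vpx p (\tr M)^-1) h3.
  rewrite scalerA mulVf // scale1r vpV // => /hv; lia.
have all n : v (t0 + n).+1 = v t0.+1 + n%:Z * T /\ v (t0 + n).+1 < v (t0 + n)%N + (D - T).
  elim: n => [|n [IH1 IH2]]; first by rewrite addn0; split => //; lia.
  by rewrite addnS; have := step _ IH2; rewrite IH1 => ->; split; lia.
exists (2 * `|v t0.+1| + 2 * t0.+1 * `|T|)%N, t0.+1 => t k ht /hv hk.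
have [e _] := all (t - t0.+1)%N.
rewrite -addSn subnKC // in e; rewrite e in hk.
have -> : t%:Z = (t - t0.+1)%N%:Z + t0.+1%:Z by lia.
move: (t - t0.+1)%N hk => n; rewrite mulrDl.
by have : - (t0.+1%:Z * `|T|%N%:Z) <= t0.+1%:Z * T; [nia|lia].
Qed.

Lemma fast_decayB (M : 'M[rat]_2) y1 y2 :
  fast_decay M y1 -> fast_decay M y2 -> fast_decay M (y1 - y2).
Proof.
move=> [C1 h1] [C2 h2]; exists (C1 + C2)%N => t; rewrite mulmxBr.
by apply: pgemB => //; [apply: pgem_le (h1 t)|apply: pgem_le (h2 t)]; lia.
Qed.

Lemma cross_exp (M : 'M[rat]_2) u v t :
  cross (M ^+ t *m u) (M ^+ t *m v) = \det M ^+ t * cross u v.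
Proof.
elim: t => [|t IHt]; first by rewrite !expr0 !mul1mx mul1r.
by rewrite !expS_mulmx cross_mulmx IHt exprS mulrA.
Qed.

(** Two independent vectors decaying fast would make [det M ^ t] decay faster than it
    does. *)
Lemma fast_decay_cross (M : 'M[rat]_2) y1 y2 :
  \det M != 0 -> 2 * vp (\tr M) < vp (\det M) ->
  fast_decay M y1 -> fast_decay M y2 -> cross y1 y2 = 0.
Proof.
move=> D0 ltTD [C1 h1] [C2 h2]; apply/eqP/negPn/negP => c0.
set c := vp (cross y1 y2).
pose t := (C1 + C2 + `|c| + 1)%N.
have := pge_cross p_prime (h1 t) (h2 t).
rewrite cross_exp pge_vp ?mulf_neq0 ?expf_neq0 // vpM ?expf_neq0 // vpX //.
rewrite -mulr_natr natz -/c; nia.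
Qed.

(** If 1 is an eigenvalue, the image of [M - 1] is the eigenline of the other one, the
    determinant; for a trace of negative valuation this is the larger eigenvalue. *)
Lemma fast_decay_eigen (M : 'M[rat]_2) u :
  \det M != 0 -> vp (\tr M) < 0 -> \det (M - 1) = 0 ->
  fast_decay M ((M - 1) *m u) -> (M - 1) *m u = 0.
Proof.
move=> D0 T0 det0 [C hC]; apply/eqP/negPn/negP => y0.
set y := (M - 1) *m u in hC y0.
have eT : \tr M - 1 = \det M.
  by move: det0; rewrite !det2 !tr2 !mxE /= => e; lra.
have My : M *m y = \det M *: y.
  rewrite /y mulmxA mulmxBr mulmx1 cayley2 -eT.
  rewrite scalemxAl; congr (_ *m u).
  by apply: mx2P; rewrite !mxE /= ?mulr1n ?mulr0n; ring.
have Mty t : M ^+ t *m y = \det M ^+ t *: y.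
  elim: t => [|t IHt]; first by rewrite !expr0 mul1mx scale1r.
  by rewrite expS_mulmx IHt -scalemxAr My scalerA exprSr.
have [v hv] := pgem_max p y0.
pose t := (C + `|v| + 1)%N.
have Dt0 : (\det M ^+ t)^-1 != 0 by rewrite invr_eq0 expf_neq0.
have := pgemZ p_prime (pge_vpx p (\det M ^+ t)^-1) (hC t).
rewrite Mty scalerA mulVf ?expf_neq0 // scale1r vpV ?expf_neq0 // vpX //.
rewrite -mulr_natr natz => /hv; rewrite mulrBr; nia.
Qed.

(** Both shapes of the Newton polygon at once, [Exc] being the set of vectors whose orbit
    does not grow at the generic rate: the origin alone if the eigenvalues have the same
    valuation, and otherwise the vectors of fast decay.  The last property serves linear
    parts with eigenvalue 1, where there may be no fixed point to translate to the origin. *)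
Lemma exceptional_directions (M : 'M[rat]_2) (a : int) : \det M != 0 ->
  (a = vp (\det M) /\ (\tr M = 0 \/ a <= 2 * vp (\tr M))) \/
  [/\ \tr M != 0, a = 2 * vp (\tr M) & a < vp (\det M)] ->
  exists Exc : 'cV[rat]_2 -> Prop,
  [/\ forall y, ~ Exc y -> exists C t0 : nat, forall (t : nat) (k : int), (t0 <= t)%N ->
        pgem k (M ^+ t *m y) -> 2 * k <= t%:Z * a + C%:Z,
      forall y1 y2, Exc y1 -> Exc y2 -> cross y1 y2 = 0,
      forall y1 y2, Exc y1 -> Exc y2 -> Exc (y1 - y2) &
      a < 0 -> \det (M - 1) = 0 -> forall u, Exc ((M - 1) *m u) -> (M - 1) *m u = 0].
Proof.
move=> D0 [[aD hT]|[T0 aT ltaD]].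
  exists (fun y => y = 0); split=> //.
  - move=> y /eqP y0; have [C hC] := pow_upper p_prime hT D0 aD y0.
    by exists C, 0%N => t k _; exact: hC.
  - by move=> y1 y2 -> _; rewrite /cross !mxE !mul0r subrr.
  - by move=> y1 y2 -> ->; rewrite subrr.
rewrite aT in ltaD *.
exists (fast_decay M); split.
- by move=> y; exact: decay_dichotomy.
- by move=> y1 y2; exact: fast_decay_cross.
- exact: fast_decayB.
- by move=> a0 det0 u; apply: fast_decay_eigen => //; lia.
Qed.

End Exceptional.

(** * Affine orbits at nonzero rate *)

Section Affine.
Variables (p : nat) (p_prime : prime p).
Local Notation vp := (vp p).
Local Notation pge := (pge p).
Local Notation pgem := (pgem p).
Variables (M : 'M[rat]_2) (s : 'cV[rat]_2).
Local Notation F := (affine_map M s).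

(** Increments obey the linear dynamics whether or not the map has a fixed point. *)
Lemma orbit_increment z t :
  iter t.+1 F z - iter t F z = M ^+ t *m ((M - 1) *m z + s).
Proof.
elim: t => [|t IHt].
  by rewrite expr0 mul1mx /= /affine_map mulmxBl mul1mx addrAC.
by rewrite expS_mulmx -IHt /= /affine_map mulmxBr opprD addrACA subrr addr0.
Qed.

Lemma orbit_linear z t : s = 0 -> iter t F z = M ^+ t *m z.
Proof.
move=> s0; elim: t => [|t IHt]; first by rewrite mul1mx.
by rewrite expS_mulmx -IHt /= /affine_map s0 addr0.
Qed.

(** A point of the orbit is the initial point plus a sum of increments, and an ultrametric
    sum is no larger than its largest term, here the first or the last one according to the
    sign of the rate. *)
Lemma orbit_lower z (a b : int) :
  (\tr M = 0 \/ a <= 2 * vp (\tr M)) -> (\det M = 0 \/ a <= vp (\det M)) ->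
  b <= a -> b <= 0 ->
  exists C : nat, forall (t : nat) (k : int),
    2 * k + C%:Z <= t%:Z * b -> pgem k (iter t F z).
Proof.
move=> hT hD ba b0.
have [C0 hC0] := pgem_neg p_prime z.
have [C1 hC1] := pgem_neg p_prime ((M - 1) *m z + s).
have [C hC] := pow_lower p_prime hT hD.
exists (C + 2 * C0 + 2 * C1 + 1)%N => t; elim: t => [|t IHt] k hk.
  by apply: pgem_le hC0; lia.
rewrite -[iter _ _ _](subrK (iter t F z)); apply: pgemD => //; last first.
  by apply: IHt; lia.
rewrite orbit_increment -(subrK (- C1%:Z) k); apply: pgem_mul => //.
apply: hC; have : t%:Z * b <= t%:Z * a by rewrite ler_wpM2l.
lia.
Qed.

Lemma orbit_step z t k C Cs : pgem (- C%:Z) M -> pgem (- Cs%:Z) s ->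
  pgem k (iter t F z) -> forall l : int, l <= k - C%:Z -> l <= - Cs%:Z ->
  pgem l (iter t.+1 F z).
Proof.
move=> hM hs hk l l1 l2; rewrite /= /affine_map; apply: pgemD => //.
  have := pgem_mul p_prime hM hk; apply: pgem_le; lia.
by apply: pgem_le hs.
Qed.

(** If a point of the orbit were much smaller than the increment, so would be the next
    one, and hence their difference, the increment itself. *)
Lemma expanding_upper z (a : int) : a < 0 ->
  (exists C t0 : nat, forall (t : nat) (k : int), (t0 <= t)%N ->
    pgem k (M ^+ t *m ((M - 1) *m z + s)) -> 2 * k <= t%:Z * a + C%:Z) ->
  exists C t0 : nat, forall (t : nat) (k : int), (t0 <= t)%N ->
    pgem k (iter t F z) -> 2 * k <= t%:Z * a + C%:Z.
Proof.
move=> a0 [C [t0 hC]].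
have [CM hM] := pgem_neg p_prime M; have [Cs hs] := pgem_neg p_prime s.
exists (C + 2 * CM)%N, (t0 + C + 2 * CM + 2 * Cs + 1)%N => t k ht hk.
rewrite leNgt; apply/negP => lt_k.
have taC : t%:Z * a <= - t%:Z by nia.
pose l := Order.min (k - CM%:Z) (- Cs%:Z).
have h1 : pgem l (iter t.+1 F z) by apply: (orbit_step hM hs hk); rewrite /l; lia.
have h2 : pgem l (iter t F z) by apply: pgem_le hk; rewrite /l; lia.
have := pgemB p_prime h1 h2; rewrite orbit_increment => /hC-/(_ _).
have -> : (t0 <= t)%N by lia.
by move=> /(_ isT); rewrite /l; lia.
Qed.

(** Increments tend to zero, so a small point would be followed by a small one; but then
    the translation [s], a combination of the two, would be small. *)
Lemma contracting_upper z (a : int) : 0 < a -> s != 0 ->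
  (\tr M = 0 \/ a <= 2 * vp (\tr M)) -> (\det M = 0 \/ a <= vp (\det M)) ->
  exists C t0 : nat, forall (t : nat) (k : int), (t0 <= t)%N ->
    pgem k (iter t F z) -> 2 * k <= C%:Z.
Proof.
move=> a0 s0 hT hD.
have [C hC] := pow_lower p_prime hT hD.
have [C1 hC1] := pgem_neg p_prime ((M - 1) *m z + s).
have [CM hM] := pgem_neg p_prime M; have [v hv] := pgem_max p s0.
pose K := (`|v| + CM + 1)%N.
exists (2 * K)%N, (2 * K + 2 * C1 + C)%N => t k ht hk.
rewrite leNgt; apply/negP => lt_k.
have h1 : pgem K%:Z (iter t F z) by apply: pgem_le hk; lia.
have h2 : pgem K%:Z (iter t.+1 F z).
  rewrite -[iter t.+1 _ _](subrK (iter t F z)); apply: pgemD => //.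
  rewrite orbit_increment -(subrK (- C1%:Z) K%:Z); apply: pgem_mul => //.
  by apply: hC; nia.
have : pgem (v + 1) s.
  have -> : s = iter t.+1 F z - M *m iter t F z by rewrite /= /affine_map addrAC subrr add0r.
  apply: pgemB => //; first by apply: pgem_le h2; lia.
  by apply: pgem_le (pgem_mul p_prime hM h1); lia.
by move=> /hv; lia.
Qed.

End Affine.

(** * Scalar affine maps at rate zero *)

(** [k = o(t)] along the pairs related by [P], in integers. *)
Definition sublinear (P : nat -> nat -> Prop) : Prop :=
  forall e : nat, exists t0 : nat, forall t k : nat, (t0 <= t)%N -> P t k -> (e * k <= t)%N.

Lemma sublinear_const (P : nat -> nat -> Prop) :
  (exists C t0 : nat, forall t k : nat, (t0 <= t)%N -> P t k -> (k <= C)%N) -> sublinear P.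
Proof.
move=> [C [t0 h]] e; exists (t0 + e * C)%N => t k ht hk.
apply: (@leq_trans (e * C)); last by lia.
by rewrite leq_mul2l (h t) ?orbT //; lia.
Qed.

Lemma sublinear_shift (P P' : nat -> nat -> Prop) (C : nat) :
  sublinear P -> (forall t k, P' t (k + C)%N -> P t k) -> sublinear P'.
Proof.
move=> hP PP e; have [t0 h] := hP (2 * e)%N.
exists (t0 + 2 * e * C)%N => t k ht hk.
have [le_kC|lt_Ck] := leqP k C; first by nia.
have : P t (k - C)%N by apply: PP; rewrite subnK // ltnW.
by move=> /(h t _ (leq_trans (leq_addr _ _) ht)); nia.
Qed.

Lemma sublinear_log (A B : nat) : sublinear (fun t k => (2 ^ k <= A + t * B)%N).
Proof.
move=> e; pose C := ((A + B) * e.+1)%N.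
have [k0 hk0] : exists k0, forall k, (k0 <= k)%N -> (C.+1 * k.+1 ^ 1 <= 2 ^ k)%N.
  by exists (C.+1 * 2 ^ 2)%N => k hk; apply: poly_leq_exp2; lia.
exists (e * k0).+1 => t k ht hk; rewrite leqNgt; apply/negP => lt_t.
have kk : (k0 <= k)%N.
  have := ltn_trans ht lt_t; rewrite ltn_mul2l => /andP[_]; lia.
have := leq_trans (hk0 k kk) hk; rewrite expn1 leqNgt => /negP; apply.
apply: (@leq_ltn_trans (A + (e * k) * B)); first by rewrite leq_add2l leq_mul2r ltnW ?orbT.
by rewrite /C; nia.
Qed.

Section Scalar.
Variables (p : nat) (p_prime : prime p).
Local Notation vp := (vp p).
Local Notation pge := (pge p).
Local Notation pgem := (pgem p).

Lemma pge_int_bound (k : nat) (n : int) : n != 0 -> pge k%:Z n%:~R -> (2 ^ k <= `|n|)%N.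
Proof.
move=> n0; rewrite pge_dvd // => /dvdn_leq h; apply: (@leq_trans (p ^ k)).
  by case: k {h} => [|k] //; rewrite leq_exp2r // prime_gt1.
by apply: h; rewrite absz_gt0.
Qed.

(** A nonzero integer divisible by [p ^ k] is at least [2 ^ k] in absolute value, while the
    numerators grow linearly in [t]. *)
Lemma translation_sublinear (x y : rat) : x != 0 ->
  sublinear (fun t k => pge k%:Z (x + t%:R * y)).
Proof.
move=> x0; have [->|y0] := eqVneq y 0.
  apply: sublinear_const; exists `|vp x|%N, 0%N => t k _.
  by rewrite mulr0 addr0 pge_vp //; lia.
pose c := denq x * denq y; pose a := numq x * denq y; pose b := numq y * denq x.
have c0 : c%:~R != 0 :> rat by rewrite intr_eq0 mulf_neq0.
have dx : (denq x)%:~R != 0 :> rat by rewrite intr_eq0 denq_neq0.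
have dy : (denq y)%:~R != 0 :> rat by rewrite intr_eq0 denq_neq0.
have e t : c%:~R * (x + t%:R * y) = (a + t%:Z * b)%:~R :> rat.
  rewrite -{1}[x]divq_num_den -{1}[y]divq_num_den /c /a /b.
  by rewrite !(rmorphM, rmorphD) /= -pmulrn; field; rewrite dx dy.
have b0 : b != 0 by rewrite mulf_neq0 ?numq_eq0.
move=> n; have [t0 ht0] := sublinear_log `|a|%N `|b|%N n.
exists (t0 + `|a|.+1)%N => t k ht hk; apply: ht0; first by lia.
have nz : a + t%:Z * b != 0 by apply/eqP => h0; move: b0 ht; nia.
apply: (@leq_trans (absz (a + t%:Z * b))); last by nia.
apply: pge_int_bound => //; rewrite -e; apply: pgeMl => //; exact: pge_int.
Qed.

Lemma affine_closed_form (la sg : rat) (xi : nat -> rat) :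
  (forall t, xi t.+1 = la * xi t + sg) -> la != 1 ->
  forall t, xi t = la ^+ t * (xi 0%N - sg / (1 - la)) + sg / (1 - la).
Proof.
move=> rec la1; have la1' : 1 - la != 0 by rewrite subr_eq0 eq_sym.
elim=> [|t IHt]; first by rewrite mul1r subrK.
by rewrite rec IHt exprS; field.
Qed.

Lemma rat_root_of_unity (la : rat) n : (0 < n)%N -> la ^+ n = 1 -> la = 1 \/ la = -1.
Proof.
move=> n0 h; have : `|la| ^+ n = 1 by rewrite -normrX h normr1.
move/eqP; rewrite pexpr_eq1 // => /eqP la1.
have [?|?] := lerP 0 la; [left|right]; first by rewrite -la1 ger0_norm.
by rewrite -la1 ltr0_norm // opprK.
Qed.

(** Closeness of the orbit to zero means that a power of [la] is close to a fixed rational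
    number.  If [la] is 1 or -1 this is elementary, apart from initial values whose
    orbit stays at, or periodically meets, zero; otherwise it is the approximation theorem
    for powers, in dimension one. *)
Lemma scalar_affine (la sg : rat) (xi : nat -> rat) :
  (forall t, xi t.+1 = la * xi t + sg) -> la != 0 -> vp la = 0 ->
  xi 0%N != 0 -> xi 0%N != sg -> (la != 1 -> xi 0%N != sg / (1 - la)) ->
  sublinear (fun t k => pge k%:Z (xi t)).
Proof.
move=> rec la0 vla x0 xs xc.
have [la1|la1] := eqVneq la 1.
  have e t : xi t = xi 0%N + t%:R * sg.
    by elim: t => [|t IHt]; rewrite ?mul0r ?addr0 // rec la1 mul1r IHt -natr1 mulrDl mul1r addrA.
  move=> n; have [t0 h] := translation_sublinear sg x0 n.
  by exists t0 => t k ht; rewrite e; exact: h.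
have [laN1|laN1] := eqVneq la (-1).
  have e t : xi t = xi 0%N \/ xi t = sg - xi 0%N.
    elim: t => [|t [IHt|IHt]]; first (by left); rewrite rec laN1 IHt; [right|left]; ring.
  apply: sublinear_const; exists (`|vp (xi 0%N)| + `|vp (sg - xi 0%N)|)%N, 0%N => t k _.
  have xs' : sg - xi 0%N != 0 by rewrite subr_eq0 eq_sym.
  by case: (e t) => ->; rewrite pge_vp //; lia.
have := affine_closed_form rec la1; have := xc la1.
set c := sg / _ => xc0 closed.
have y0 : xi 0%N - c != 0 by rewrite subr_eq0.
have [c0|c0] := eqVneq c 0.
  apply: sublinear_const; exists `|vp (xi 0%N)|%N, 0%N => t k _.
  rewrite (closed t) c0 subr0 addr0 pge_vp ?mulf_neq0 ?expf_neq0 // vpM ?expf_neq0 //.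
  by rewrite vpX // vla mul0rn; lia.
pose N := - c / (xi 0%N - c).
have N0 : N != 0 by rewrite mulf_neq0 ?oppr_eq0 ?invr_eq0.
pose C := `|vp (xi 0%N - c)|%N.
have close t k : pge (k + C)%N%:Z (xi t) -> pge k%:Z (la ^+ t - N).
  move=> h; have -> : la ^+ t - N = (xi 0%N - c)^-1 * xi t by rewrite (closed t) /N; field.
  have := pgeM p_prime (pge_vpx p (xi 0%N - c)^-1) h.
  by apply: pge_le; rewrite vpV // /C; move: (vp _) => v; clear; lia.
have pla t : pge 0 (la ^+ t) by rewrite pge_vp ?expf_neq0 // vpX // vla mul0rn.
apply: (sublinear_shift (P := fun t k => pge k%:Z (la ^+ t - N)) (C := C)) => //.
have [pN|pN] := boolP (pge 0 N); last first.
  apply: sublinear_const; exists 0%N, 0%N => t k _ hk.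
  case/negP: pN; have -> : N = la ^+ t - (la ^+ t - N) by ring.
  by apply: pgeB => //; apply: pge_le hk.
have la_inf n : (0 < n)%N -> (ratr la : algC) ^+ n != 1.
  move=> n0; apply/eqP => h; have : la ^+ n = 1.
    by apply: (fmorph_inj (@ratr algC)); rewrite rmorphXn rmorph1 h.
  by move=> /(rat_root_of_unity n0) [] /eqP; apply/negP.
move=> e.
have [||||||||||t0 ht0] := @power_not_close p 0 e la%:M N%:M
  (1%:M : 'rV[algC]_1) (ratr la) (ratr N) p_prime.
- by rewrite -(expr1 la) => i j; rewrite mxE !ord1 eqxx mulr1n.
- by move=> i j; rewrite mxE !ord1 eqxx mulr1n.
- by rewrite det_scalar1.
- by rewrite det_scalar1.
- exact: oner_neq0.
- by rewrite map_scalar_mx /= mul1mx -scalemx1.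
- by rewrite map_scalar_mx /= mul1mx -scalemx1.
- by rewrite fmorph_eq0.
- by rewrite fmorph_eq0.
- exact: la_inf.
exists t0 => t k ht hk; apply: ht0 => // i j.
rewrite !ord1.
have -> : la%:M ^+ t = (la ^+ t)%:M :> 'M[rat]_1 by rewrite rmorphXn.
by rewrite !mxE eqxx !mulr1n.
Qed.

End Scalar.

(** * Sets of density zero *)

(** A quantitative form of zero density, stable under finite unions. *)
Definition thin (A : set 'cV[rat]_2) : Prop :=
  exists c : nat, forall N, (N * ball_count A N <= c * ball_count setT N)%N.

Definition collinear (A : set 'cV[rat]_2) : Prop :=
  forall z1 z2 z3, A z1 -> A z2 -> A z3 -> cross (z2 - z1) (z3 - z1) = 0.

Lemma finite_ball (A : set 'cV[rat]_2) N : finite_set (A `&` height_ball N).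
Proof. by apply: sub_finite_set (finite_height_ball N) => z []. Qed.

Lemma ball_count_le (A B : set 'cV[rat]_2) N : A `<=` B -> (ball_count A N <= ball_count B N)%N.
Proof.
move=> AB; apply: uniq_leq_size; first exact: finmap.fset_uniq.
move=> z; rewrite !in_fset_set; try exact: finite_ball.
by rewrite !inE => -[Az hz]; split=> //; exact: AB.
Qed.

Lemma ball_countU (A B : set 'cV[rat]_2) N :
  (ball_count (A `|` B) N <= ball_count A N + ball_count B N)%N.
Proof.
rewrite /ball_count -size_cat; apply: uniq_leq_size; first exact: finmap.fset_uniq.
move=> z; rewrite mem_cat !in_fset_set; try exact: finite_ball.
by rewrite !inE => -[[Az|Bz] hz]; apply/orP; [left|right]; rewrite inE.
Qed.

Lemma thin_sub (A B : set 'cV[rat]_2) : A `<=` B -> thin B -> thin A.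
Proof.
move=> AB [c hc]; exists c => N; apply: leq_trans (hc N).
by rewrite leq_mul2l ball_count_le ?orbT.
Qed.

Lemma thinU (A B : set 'cV[rat]_2) : thin A -> thin B -> thin (A `|` B).
Proof.
move=> [c hc] [d hd]; exists (c + d)%N => N; rewrite mulnDl.
apply: leq_trans (leq_add (hc N) (hd N)).
by rewrite -mulnDr leq_mul2l ball_countU orbT.
Qed.

Lemma rat_height_nat (i : nat) : rat_height i%:R = maxn i 1.
Proof. by rewrite /rat_height -[i%:R]/(i%:Z%:~R) numq_int denq_int. Qed.

(** Along a line one coordinate determines the point, so that the other can be replaced
    by any of [N] integers without losing injectivity. *)
Lemma collinear_thin (A : set 'cV[rat]_2) : collinear A -> thin A.
Proof.
move=> colA; exists 1%N => N; rewrite mul1n.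
suff [g [g_inj g_ball]] : exists g : nat -> 'cV[rat]_2 -> 'cV[rat]_2,
    (forall i j z w, A z -> A w -> g i z = g j w -> i = j /\ z = w) /\
    (forall i z, (i < N)%N -> height_ball N z -> height_ball N (g i z)).
  rewrite /ball_count -{1}(size_iota 0 N) -(size_allpairs g).
  apply: uniq_leq_size.
    apply: allpairs_uniq; [exact: iota_uniq|exact: finmap.fset_uniq|].
    move=> [i z] [j w] /allpairsP[[i' z']/= []] _ hz [-> ->].
    move=> /allpairsP[[j' w']/= []] _ hw [-> ->].
    move: hz hw; rewrite !in_fset_set; try exact: finite_ball.
    rewrite !inE => -[Az _] [Aw _] /g_inj[] // -> ->; exact: (erefl _).
  move=> z /allpairsP[[i w]/= [hi hw ->]].
  move: hi hw; rewrite mem_iota !in_fset_set; try exact: finite_ball.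
  by rewrite !inE /= => hi -[_ hw]; split=> //; exact: g_ball.
pose gr i (z : 'cV[rat]_2) : 'cV[rat]_2 := \col_k (if k == 0 then i%:R else z 1 0).
pose gl i (z : 'cV[rat]_2) : 'cV[rat]_2 := \col_k (if k == 0 then z 0 0 else i%:R).
have hN i (z : 'cV[rat]_2) : (i < N)%N -> (maxn i 1 <= N)%N by lia.
have [[a [b [Aa Ab ab]]]|vert] := pselect (exists a b, [/\ A a, A b & a 0 0 != b 0 0]).
  exists gl; split=> [i j z w Az Aw /colP e|i z ltiN].
    have := e 0; have := e 1; rewrite !mxE /= => /eqP; rewrite eqr_nat => /eqP eij e0.
    split=> //; apply: col2P => //.
    have [c [Ac c0]] : exists c, A c /\ c 0 0 != z 0 0.
      have [az|] := eqVneq (a 0 0) (z 0 0); last by exists a.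
      by exists b; rewrite -az eq_sym.
    have /eqP := colA _ _ _ Az Aw Ac; rewrite /cross !mxE -e0 subrr mul0r sub0r.
    rewrite oppr_eq0 mulf_eq0 !subr_eq0 (negPf c0) orbF => /eqP ->.
    by [].
  rewrite /height_ball /= /point_height !mxE /= rat_height_nat !geq_max.
  by move=> /andP[-> _] /=; rewrite -geq_max hN.
exists gr; split=> [i j z w Az Aw /colP e|i z ltiN].
  have := e 0; have := e 1; rewrite !mxE /= => e1 /eqP; rewrite eqr_nat => /eqP eij.
  split=> //; apply: col2P => //; apply/eqP/negPn/negP => ne.
  by apply: vert; exists z, w.
rewrite /height_ball /= /point_height !mxE /= rat_height_nat !geq_max.
by move=> /andP[_ ->]; rewrite andbT -geq_max hN.
Qed.

Lemma thin1 (z : 'cV[rat]_2) : thin [set z].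
Proof.
by apply: collinear_thin => z1 z2 z3 /= -> -> ->; rewrite /cross !mxE !subrr.
Qed.

Lemma thin_bigcup (n : nat) (A : nat -> set 'cV[rat]_2) :
  (forall i, (i < n)%N -> thin (A i)) -> thin [set z | exists2 i, (i < n)%N & A i z].
Proof.
elim: n => [|n IHn] hA.
  by exists 0%N => N; rewrite /ball_count (_ : _ `&` _ = set0) ?fset_set0 ?muln0 //;
     apply/seteqP; split => // z [[]].
apply: (thin_sub (B := [set z | exists2 i, (i < n)%N & A i z] `|` A n)).
  move=> z /= [i]; rewrite ltnS leq_eqVlt => /orP[/eqP->|h] Az; [by right|].
  by left; exists i.
by apply: thinU; [apply: IHn => i h; apply: hA; exact: ltnW|exact: hA].
Qed.

Lemma ball_count_gt (N : nat) : (N <= ball_count setT N)%N.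
Proof.
case: N => [//|N].
pose g (i : nat) : 'cV[rat]_2 := \col_k (i%:R).
rewrite /ball_count -{1}(size_iota 0 N.+1) -(size_map g); apply: uniq_leq_size.
  rewrite map_inj_uniq ?iota_uniq // => i j /colP/(_ 0); rewrite !mxE => /eqP.
  by rewrite eqr_nat => /eqP.
move=> z /mapP[i]; rewrite mem_iota => hi ->; rewrite in_fset_set; last exact: finite_ball.
rewrite inE; split=> //; rewrite /height_ball /= /point_height !mxE !rat_height_nat; lia.
Qed.

Lemma cvg_invn (R : realType) : (fun N : nat => (N%:R : R)^-1) @ \oo --> (0 : R).
Proof.
apply/gtr0_cvgV0; last exact: cvgr_idn.
by near=> N; rewrite ltr0n; near: N; exact: nbhs_infty_gt.
Unshelve. all: by end_near.
Qed.

Lemma thin_almost_all (R : realType) (P : 'cV[rat]_2 -> Prop) :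
  thin [set z | ~ P z] -> almost_all R setT P.
Proof.
move=> [c hc]; rewrite /almost_all /has_density.
have tot (N : nat) : (0 < N)%N -> (0 < ball_count setT N)%N.
  by move=> N0; apply: leq_trans (ball_count_gt N).
have lower N : (0 < N)%N -> 1 - c%:R * N%:R^-1 <=
    (ball_count [set z | setT z /\ P z] N)%:R / (ball_count setT N)%:R :> R.
  move=> N0; have t0 := tot N N0.
  have tR : (0 : R) < (ball_count setT N)%:R by rewrite ltr0n.
  have NR : (0 : R) < N%:R by rewrite ltr0n.
  rewrite ler_pdivlMr // mulrBl mul1r lerBlDr.
  have hu : (ball_count setT N <=
      ball_count [set z | setT z /\ P z] N + ball_count [set z | ~ P z] N)%N.
    apply: leq_trans (ball_countU _ _ _); apply: ball_count_le => z _.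
    by have [h|h] := pselect (P z); [left|right].
  have : (ball_count setT N)%:R <=
      (ball_count [set z | setT z /\ P z] N)%:R + (ball_count [set z | ~ P z] N)%:R :> R.
    by rewrite -natrD ler_nat.
  move/le_trans; apply; rewrite lerD2l mulrAC ler_pdivlMr // mulrC -!natrM ler_nat.
  exact: hc.
have upper N : (ball_count [set z | setT z /\ P z] N)%:R / (ball_count setT N)%:R <= 1 :> R.
  case: (posnP N) => [->|N0].
    have : (ball_count [set z | setT z /\ P z] 0 <= ball_count setT 0)%N by apply: ball_count_le.
    case: (posnP (ball_count setT 0)) => [->|t0 hle]; first by rewrite invr0 mulr0.
    by rewrite ler_pdivrMr ?ltr0n // mul1r ler_nat.
  rewrite ler_pdivrMr ?ltr0n ?tot // mul1r ler_nat; exact: ball_count_le.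
have lim1 : (fun N : nat => 1 - c%:R * N%:R^-1 : R) @ \oo --> (1 : R).
  rewrite -[X in _ --> X]subr0 -(mulr0 c%:R); apply: cvgB; first exact: cvg_cst.
  apply: cvgM; [exact: cvg_cst|exact: cvg_invn].
apply: (squeeze_cvgr _ lim1 (cvg_cst _)).
near=> N; rewrite upper andbT lower //; near: N; exact: nbhs_infty_gt.
Unshelve. all: by end_near.
Qed.

(** * Planar affine maps at rate zero, without rational eigenvalue *)

Lemma cross_eq0 (u v : 'cV[rat]_2) : u != 0 -> cross u v = 0 -> exists la, v = la *: u.
Proof.
move=> u0 /eqP; rewrite /cross subr_eq0 => /eqP e.
have [h0|h0] := eqVneq (u 0 0) 0; last first.
  exists (v 0 0 / u 0 0); apply: col2P; rewrite !mxE ?divfK //.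
  by apply: (mulfI h0); rewrite e; field.
have h1 : u 1 0 != 0.
  by apply: contra_neq u0 => h1; apply: col2P; rewrite mxE.
exists (v 1 0 / u 1 0); apply: col2P; rewrite !mxE ?divfK //.
by apply: (mulfI h1); rewrite -e h0; field.
Qed.

Section Irreducible.
Variables (p : nat) (p_prime : prime p).
Local Notation vp := (vp p).
Local Notation pge := (pge p).
Local Notation pgem := (pgem p).
Variables (M : 'M[rat]_2) (s : 'cV[rat]_2).
Local Notation F := (affine_map M s).
Local Notation T := (\tr M).
Local Notation D := (\det M).
Hypothesis irr : forall la : rat, la ^+ 2 - T * la + D != 0.

Lemma irr_cross z : z != 0 -> cross z (M *m z) != 0.
Proof.
move=> z0; apply/eqP => /(cross_eq0 z0)[la Mz].
have := exp_mulmx_recurrence M z 0; rewrite expr0 mul1mx expr1 Mz => e.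
have : (la ^+ 2 - T * la + D) *: z = 0.
  have e2 : M ^+ 2 *m z = la ^+ 2 *: z.
    by rewrite expS_mulmx expr1 Mz -scalemxAr Mz scalerA.
  by rewrite scalerDl scalerBl -e2 e scalerA addrAC subrK subrr.
by move/eqP; rewrite scaler_eq0 (negPf z0) orbF; apply/negP.
Qed.

Lemma fixed_point : exists zs, M *m zs + s = zs.
Proof.
have u : 1%:M - M \in unitmx.
  rewrite unitmxE det2 !mxE /= unitfE; apply: contra_neq (irr 1) => e.
  by rewrite det2 tr2 -e; ring.
exists (invmx (1%:M - M) *m s); set zs := _ *m s.
have : (1%:M - M) *m zs = s by rewrite mulKVmx.
by rewrite mulmxBl mul1mx => <-; rewrite addrC subrK.
Qed.

Lemma orbit_fixed zs z t : M *m zs + s = zs -> iter t F z = M ^+ t *m (z - zs) + zs.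
Proof.
move=> hzs; elim: t => [|t IHt]; first by rewrite expr0 mul1mx subrK.
by rewrite iterS IHt expS_mulmx /affine_map mulmxDr -addrA hzs.
Qed.

(** As [t] grows, [cross] of [M ^ t y] and its image tends to zero p-adically because the
    determinant does.  Were [x_t] small, [M ^ t y] would be close to [- zs], whose [cross]
    with its image is a nonzero constant: there is no rational eigenvector. *)
Lemma irreducible_mixed z zs : M *m zs + s = zs -> zs != 0 -> D != 0 -> 0 < vp D ->
  sublinear (fun t k => pgem k%:Z (iter t F z)).
Proof.
move=> hzs zs0 D0 vD; pose y := z - zs.
have R0 := irr_cross zs0; set R := cross zs _ in R0.
have [CM hM] := pgem_neg p_prime M; have [Cz hz] := pgem_neg p_prime zs.
have [C0 hC0] : exists C0 : nat, pge (- C0%:Z) (cross y (M *m y)).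
  by exists `|vp (cross y (M *m y))|%N; apply: pge_le (pge_vpx p _); lia.
apply: sublinear_const; exists (`|vp R| + CM + Cz)%N, (`|vp R| + C0 + 1)%N => t k ht hk.
rewrite leqNgt; apply/negP => lt_k; set x := iter t F z in hk.
have ex : M ^+ t *m y = x - zs by rewrite /x (orbit_fixed _ _ hzs) addrK.
(* Expanding [cross (x - zs) (M *m (x - zs))]: all terms but the first contain [x]. *)
have eR : R = D ^+ t * cross y (M *m y) - cross x (M *m (x - zs)) + cross zs (M *m x).
  rewrite -cross_exp mulmxA -[M ^+ t *m M]/(M ^+ t * M) -exprSr expS_mulmx ex.
  by rewrite mulmxBr !(crossDl, crossDr, crossNl, crossNr) /R; ring.
have : pge (vp R + 1) R.
  rewrite {2}eR; apply: pgeD => //; first apply: pgeB => //.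
  - have : pge (t%:Z - C0%:Z) (D ^+ t * cross y (M *m y)).
      apply: pgeM => //; rewrite pge_vp ?expf_neq0 // vpX // -mulr_natr natz; nia.
    by apply: pge_le; lia.
  - have hx : pgem (- Cz%:Z) (x - zs) by apply: pgemB => //; apply: pgem_le hk; lia.
    have := pge_cross p_prime hk (pgem_mul p_prime hM hx).
    by apply: pge_le; lia.
  have := pge_cross p_prime hz (pgem_mul p_prime hM hk).
  by apply: pge_le; lia.
by rewrite pge_vp //; lia.
Qed.

Lemma quadratic_root : exists mu : algC,
  mu ^+ 2 = ratr T * mu - ratr D /\ forall x : rat, mu != ratr x.
Proof.
pose d := (ratr T : algC) ^+ 2 - 4%:R * ratr D.
pose mu := (ratr T + sqrtC d) / 2%:R.
have e : mu ^+ 2 = ratr T * mu - ratr D.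
  have h := sqrtCK d; rewrite {2}/d in h.
  have -> : mu ^+ 2 = (ratr T ^+ 2 + 2%:R * ratr T * sqrtC d + sqrtC d ^+ 2) / 4%:R.
    by rewrite /mu; field.
  by rewrite h /mu; field.
exists mu; split=> // x; apply: contra_neq (irr x) => ex.
apply: (fmorph_inj (@ratr algC)); rewrite rmorph0 rmorphD rmorphB rmorphXn rmorphM /=.
by rewrite -ex e; ring.
Qed.

(** The same pair of rational coordinates represents [M ^ t] and [mu ^ t], because [M] and
    [mu] satisfy the same quadratic equation. *)
Lemma power_coords (mu : algC) t : mu ^+ 2 = ratr T * mu - ratr D ->
  exists a b : rat, M ^+ t = a%:M + b *: M /\ mu ^+ t = ratr a + ratr b * mu.
Proof.
move=> emu; elim: t => [|t [a [b [eM em]]]].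
  exists 1, 0; split; first by rewrite expr0 scale0r addr0.
  by rewrite expr0 rmorph1 rmorph0 mul0r addr0.
exists (- b * D), (a + b * T); split.
  rewrite exprSr eM -[_ * M]/(_ *m M) mulmxDl -scalemxAl cayley2.
  by apply: mx2P; rewrite mul_scalar_mx !mxE /= ?mulr1n ?mulr0n; ring.
have -> : mu ^+ t.+1 = ratr a * mu + ratr b * mu ^+ 2 by rewrite exprSr em; ring.
by rewrite emu rmorphD !rmorphM rmorphN /=; ring.
Qed.

Lemma root_of_unity_power (mu : algC) n :
  mu ^+ 2 = ratr T * mu - ratr D -> (forall x : rat, mu != ratr x) ->
  mu ^+ n = 1 -> M ^+ n = 1.
Proof.
move=> emu mu_irr mun; have [a [b [-> em]]] := power_coords n emu.
rewrite mun in em.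
have b0 : b = 0.
  apply/eqP/negPn/negP => b0; have rb0 : ratr b != 0 :> algC by rewrite fmorph_eq0.
  have := mu_irr ((1 - a) / b); rewrite fmorph_div rmorphB rmorph1 /= em.
  by rewrite addrAC subrr add0r mulrAC divff // mul1r eqxx.
have a1 : a = 1.
  apply: (fmorph_inj (@ratr algC)); rewrite rmorph1.
  by rewrite em b0 rmorph0 mul0r addr0.
by rewrite a1 b0 scale0r addr0.
Qed.

(** The orbit is periodic, so its valuations are bounded as soon as it avoids the
    origin. *)
Lemma finite_order_sublinear n z : (0 < n)%N -> M ^+ n = 1 ->
  (forall j, (j < n)%N -> iter j F z <> 0) ->
  sublinear (fun t k => pgem k%:Z (iter t F z)).
Proof.
move=> n0 Mn nz; have [zs hzs] := fixed_point.
have per t : iter t F z = iter (t %% n) F z.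
  rewrite !(orbit_fixed _ _ hzs) {1}(divn_eq t n) exprD mulnC exprM Mn expr1n mul1r.
  by [].
apply: sublinear_const.
have [C hC] : exists C : nat, forall j, (j < n)%N -> forall k : nat,
    pgem k%:Z (iter j F z) -> (k <= C)%N.
  elim: {1 3}n (leqnn n) => [|m IHm] hm; first by exists 0%N.
  have [C hC] := IHm (ltnW hm).
  have /eqP/(pgem_max p)[v hv] := nz m hm.
  exists (C + `|v|)%N => j; rewrite ltnS leq_eqVlt => /orP[/eqP->|hj] k.
    by move=> /hv; lia.
  by move=> /(hC j hj); lia.
by exists C, 0%N => t k _; rewrite per; apply: hC; rewrite ltn_mod.
Qed.

(** In the basis [y, M y] the matrix becomes the companion matrix [Mc], which is p-integral,
    and the vector [- zs] becomes the first column of a matrix [N] of the algebra generated by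
    [Mc].  The point [x_t] is then the first column of [Mc ^ t - N], which determines the
    second one, so a small [x_t] makes [Mc ^ t] close to [N]. *)
Lemma irreducible_unit_sublinear z zs (mu : algC) :
  D != 0 -> vp D = 0 -> pge 0 T ->
  M *m zs + s = zs -> zs != 0 -> z != zs ->
  mu ^+ 2 = ratr T * mu - ratr D -> (forall x : rat, mu != ratr x) ->
  (forall n, (0 < n)%N -> mu ^+ n != 1) ->
  sublinear (fun t k => pgem k%:Z (iter t F z)).
Proof.
move=> D0 vD pT hzs zs0 zzs emu mu_irr mu_inf.
have [y ey] : exists y, y = z - zs by exists (z - zs).
have y0 : y != 0 by rewrite ey subr_eq0.
have [u eu] : exists u, u = M *m y by exists (M *m y).
pose P : 'M[rat]_2 := \matrix_(i, j) (if j == 0 then y i 0 else u i 0).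
pose Mc : 'M[rat]_2 := \matrix_(i, j)
  (if j == 0 then (if i == 0 then 0 else 1) else (if i == 0 then - D else T)).
pose e0 : 'cV[rat]_2 := \col_i (if i == 0 then 1 else 0).
have Pu : P \in unitmx.
  rewrite unitmxE det2 !mxE /= unitfE; have := irr_cross y0; rewrite -eu /cross.
  by apply: contra_neq => <-; ring.
have Pe0 : P *m e0 = y by apply: col2P; rewrite mulmx2E !mxE /=; ring.
have MP : M *m P = P *m Mc.
  have h' : M *m u = T *: u - D *: y.
    by have := exp_mulmx_recurrence M y 0; rewrite expS_mulmx expr1 expr0 mul1mx eu.
  have c0 i : (M *m P) i 0 = u i 0 by rewrite eu !mulmx2E !mxE.
  have c1 i : (M *m P) i 1 = T * u i 0 - D * y i 0.
    by have /colP/(_ i) := h'; rewrite !mulmx2E !mxE /=.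
  by apply: mx2P; rewrite ?c0 ?c1 mulmx2E !mxE /=; ring.
have MtP t : M ^+ t *m P = P *m Mc ^+ t.
  elim: t => [|t IHt]; first by rewrite !expr0 mul1mx mulmx1.
  rewrite !exprSr -[M ^+ t * M]/(_ *m M) -[Mc ^+ t * Mc]/(_ *m Mc).
  by rewrite -mulmxA MP mulmxA IHt mulmxA.
pose ab := invmx P *m (- zs); pose N : 'M[rat]_2 := (ab 0 0)%:M + ab 1 0 *: Mc.
have Ne0 : N *m e0 = ab.
  by apply: col2P; rewrite mulmx2E !mxE /= ?mulr1n ?mulr0n; ring.
have orb t : iter t F z = P *m ((Mc ^+ t - N) *m e0).
  rewrite mulmxBl Ne0 mulmxBr mulmxA -MtP -mulmxA Pe0 /ab mulKVmx // opprK ey.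
  exact: orbit_fixed.
have ab0 : ab != 0.
  apply: contra_neq zs0 => h; apply: oppr_inj.
  by rewrite oppr0 -[- zs](mulKVmx Pu) -/ab h mulmx0.
have Mcomm t : (Mc ^+ t - N) *m Mc = Mc *m (Mc ^+ t - N).
  rewrite mulmxBl mulmxBr; congr (_ - _).
    by rewrite -[LHS]/(_ * _) -[RHS]/(_ * _) -exprSr exprS.
  by rewrite mulmxDl mulmxDr -scalemxAl -scalemxAr scalar_mxC.
have pMc : pgem 0 Mc.
  have pD : pge 0 D by rewrite pge_vp // vD.
  apply: ord2P; apply: ord2P; rewrite mxE /= ?pgeN ?pge0 //.
  exact: (pge_nat p_prime 1).
have pMct t : pgem 0 (Mc ^+ t).
  elim: t => [|t IHt]; first by rewrite expr0; exact: (@pgem1 p p_prime 2).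
  by rewrite exprS -[Mc * _]/(Mc *m _); have := pgem_mul p_prime pMc IHt; rewrite addr0.
have [C hC] := pgem_neg p_prime (invmx P).
have close t (k : nat) : pgem (k + C)%N%:Z (iter t F z) -> pgem k%:Z (Mc ^+ t - N).
  move=> h; have h0 : pgem k%:Z ((Mc ^+ t - N) *m e0).
    rewrite -[_ *m e0](mulKmx Pu) -orb.
    by apply: pgem_le (pgem_mul p_prime hC h); lia.
  have h1 : pgem k%:Z (Mc *m ((Mc ^+ t - N) *m e0)).
    by have := pgem_mul p_prime pMc h0; rewrite add0r.
  rewrite mulmxA -Mcomm -mulmxA in h1.
  have z00 : (Mc *m e0) 0 0 = 0 by rewrite mulmx2E !mxE /=; ring.
  have z10 : (Mc *m e0) 1 0 = 1 by rewrite mulmx2E !mxE /=; ring.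
  have e00 : e0 0 0 = 1 by rewrite mxE.
  have e10 : e0 1 0 = 0 by rewrite mxE.
  move=> i; apply: ord2P.
    by have := h0 i 0; rewrite mulmx2E e00 e10 mulr1 mulr0 addr0.
  by have := h1 i 0; rewrite mulmx2E z00 z10 mulr1 mulr0 add0r.
apply: (sublinear_shift (P := fun t k => pgem k%:Z (Mc ^+ t - N)) (C := C)) => //.
have [pN|pN] := pselect (pgem 0 N); last first.
  apply: sublinear_const; exists 0%N, 0%N => t k _ hk; case: pN.
  have -> : N = Mc ^+ t - (Mc ^+ t - N) by rewrite opprB addrC subrK.
  by apply: pgemB => //; apply: pgem_le hk.
pose w : 'rV[algC]_2 := \row_j (if j == 0 then 1 else mu).
have mu0 : mu != 0 by have := mu_irr 0; rewrite rmorph0.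
have detMc : \det Mc = D by rewrite det2 !mxE /=; ring.
have wMc : w *m map_mx ratr Mc = mu *: w.
  apply/rowP; apply: ord2P; rewrite mulmx2E !mxE /= ?rmorph0 ?rmorph1 ?rmorphN; first by ring.
  by rewrite -expr2 emu; ring.
have wN : w *m map_mx ratr N = (ratr (ab 0 0) + ratr (ab 1 0) * mu) *: w.
  rewrite map_mxD map_mxZ map_scalar_mx /= mulmxDr -scalemxAr wMc mul_mx_scalar.
  by rewrite scalerA -scalerDl.
have eta0 : ratr (ab 0 0) + ratr (ab 1 0) * mu != 0.
  have [b0|b0] := eqVneq (ab 1 0) 0.
    rewrite b0 rmorph0 mul0r addr0 fmorph_eq0; apply: contra_neq ab0 => a0.
    by apply: col2P; rewrite ?a0 ?b0 mxE.
  have rb0 : ratr (ab 1 0) != 0 :> algC by rewrite fmorph_eq0.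
  apply: contra_neq (mu_irr (- ab 0 0 / ab 1 0)) => h.
  rewrite fmorph_div rmorphN /=; apply: (mulfI rb0); rewrite [RHS]mulrC divfK //.
  by apply/eqP; rewrite -subr_eq0 opprK addrC h.
move=> e; have [|||t0 ht0] := @power_not_close p 1 e Mc N w mu
    (ratr (ab 0 0) + ratr (ab 1 0) * mu) p_prime pMc pN _ _ _ wMc wN mu0 eta0 mu_inf.
- by rewrite detMc.
- by rewrite detMc.
- by apply/eqP => /rowP/(_ 0); rewrite !mxE /=; apply/eqP; exact: oner_neq0.
by exists t0 => t k ht hk; apply: ht0.
Qed.

Lemma irreducible_sublinear :
  s != 0 -> D != 0 ->
  (vp D = 0 /\ pge 0 T) \/ 0 < vp D ->
  exists E : set 'cV[rat]_2, thin E /\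
    forall z, ~ E z -> sublinear (fun t k => pgem k%:Z (iter t F z)).
Proof.
move=> s0 D0 cases; have [zs hzs] := fixed_point.
have zs0 : zs != 0 by apply: contra_neq s0 => h; move: hzs; rewrite h mulmx0 add0r.
case: cases => [[vD pT]|vD]; last first.
  by exists [set zs]; split; [exact: thin1|move=> z _; exact: irreducible_mixed hzs _ _ _].
have [mu [emu mu_irr]] := quadratic_root.
have [[n [n0 mun]]|mu_inf] := pselect (exists n, (0 < n)%N /\ mu ^+ n = 1).
  have Mn := root_of_unity_power emu mu_irr mun.
  (* The period [n] depends on [M] alone, so only finitely many points reach the origin. *)
  exists [set z | exists2 j, (j < n)%N & [set z | iter j F z = 0] z]; split.
    apply: thin_bigcup => j _; apply: collinear_thin => z1 z2 z3 /= h1 h2 h3.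
    have inj z z' : iter j F z = 0 -> iter j F z' = 0 -> z = z'.
      rewrite !(orbit_fixed _ _ hzs) => h h'; apply/eqP; rewrite -subr_eq0.
      rewrite -(exp_mulmx_eq0 j _ D0).
      have -> : z - z' = (z - zs) - (z' - zs) by rewrite opprB addrA subrK.
      by rewrite mulmxBr -[X in X - _](addrK zs) h -[X in _ - X](addrK zs) h' subrr.
    by rewrite (inj z2 z1) // (inj z3 z1) // subrr /cross !mxE !mul0r subrr.
  move=> z hz; apply: (finite_order_sublinear n0 Mn) => j hj h.
  by apply: hz; exists j.
exists [set zs]; split; first exact: thin1.
move=> z zE; apply: (irreducible_unit_sublinear D0 vD pT hzs zs0 _ emu mu_irr).
  by apply/eqP.
by move=> n n0; apply/eqP => h; apply: mu_inf; exists n.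
Qed.

End Irreducible.

(** * Heights *)

Lemma kernel_cross (l : 'rV[rat]_2) (u v : 'cV[rat]_2) :
  l != 0 -> l *m u = 0 -> l *m v = 0 -> cross u v = 0.
Proof.
move=> l0 /matrixP/(_ 0 0) hu /matrixP/(_ 0 0) hv.
rewrite !mulmx2E !mxE in hu hv.
have h0 : l 0 0 * cross u v = 0.
  have -> : l 0 0 * cross u v = (l 0 0 * u 0 0 + l 0 1 * u 1 0) * v 1 0 -
    (l 0 0 * v 0 0 + l 0 1 * v 1 0) * u 1 0 by rewrite /cross; ring.
  by rewrite hu hv !mul0r subrr.
have h1 : l 0 1 * cross u v = 0.
  have -> : l 0 1 * cross u v = (l 0 0 * v 0 0 + l 0 1 * v 1 0) * u 0 0 -
    (l 0 0 * u 0 0 + l 0 1 * u 1 0) * v 0 0 by rewrite /cross; ring.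
  by rewrite hu hv !mul0r subrr.
apply/eqP/negPn/negP => c0; move/eqP: l0; apply; apply/rowP; apply: ord2P; rewrite mxE.
  by move/eqP: h0; rewrite mulf_eq0 (negPf c0) orbF => /eqP.
by move/eqP: h1; rewrite mulf_eq0 (negPf c0) orbF => /eqP.
Qed.

Lemma thin_line (l : 'rV[rat]_2) (c : rat) : l != 0 ->
  thin [set z | (l *m z) 0 0 = c].
Proof.
move=> l0; apply: collinear_thin => z1 z2 z3 /= h1 h2 h3.
apply: (kernel_cross l0); rewrite mulmxBr; apply/matrixP => i j;
  rewrite !ord1 [LHS]mxE [X in _ + X]mxE [RHS]mxE.
  by rewrite h1 h2 subrr.
by rewrite h1 h3 subrr.
Qed.

Section Heights.
Variables (p : nat) (p_prime : prime p).
Local Notation vp := (vp p).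
Local Notation pge := (pge p).
Local Notation pgem := (pgem p).
Variables (M : 'M[rat]_2) (s : 'cV[rat]_2).
Local Notation F := (affine_map M s).
Local Notation T := (\tr M).
Local Notation D := (\det M).

(** Rational eigenvalues are p-integral with product [D] and sum [T]: one of them has to
    be a unit. *)
Lemma unit_root (la : rat) : D != 0 -> pge 0 T -> 0 <= vp D ->
  vp D = 0 \/ vp T = 0 /\ T != 0 ->
  la ^+ 2 - T * la + D = 0 ->
  exists la : rat, [/\ la ^+ 2 - T * la + D = 0, la != 0 & vp la = 0].
Proof.
move=> D0 pT pD cases root_la.
have integral x : x ^+ 2 - T * x + D = 0 -> x != 0 /\ 0 <= vp x.
  move=> root_x; have x0 : x != 0.
    by apply: contra_neq D0 => x0; move: root_x; rewrite x0 mulr0 subr0 expr0n add0r.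
  split=> //; rewrite leNgt; apply/negP => vx.
  have : pge (vp x) (x ^+ 2).
    have -> : x ^+ 2 = T * x - D by apply/eqP; rewrite -subr_eq0 -root_x; apply/eqP; ring.
    apply: pgeB => //; first by apply: pgeMl => //; exact: pge_vpx.
    by rewrite pge_vp //; lia.
  by rewrite pge_vp ?expf_neq0 // vpX // mulr2n; lia.
have root_la' : (T - la) ^+ 2 - T * (T - la) + D = 0 by rewrite -[RHS]root_la; ring.
have [l0 vl] := integral _ root_la; have [l0' vl'] := integral _ root_la'.
have e : vp la + vp (T - la) = vp D.
  rewrite -vpM //; congr vp; apply/eqP; rewrite -subr_eq0 -oppr_eq0 -root_la.
  by apply/eqP; ring.
have [z|nz] := eqVneq (vp la) 0; first by exists la.
exists (T - la); split=> //; case: cases => [|[vT T0]]; first by lia.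
apply/eqP/negPn/negP => nz'.
have : pge 1 T.
  have -> : T = la + (T - la) by rewrite addrC subrK.
  by apply: pgeD => //; rewrite pge_vp //; lia.
by rewrite pge_vp // vT.
Qed.

(** A rational eigencovector [l] turns the orbit into one of a scalar affine map, and a
    small point has a small image under [l].  The exceptional points lie on three lines. *)
Lemma eigenvalue_sublinear (la : rat) :
  la ^+ 2 - T * la + D = 0 -> la != 0 -> vp la = 0 ->
  exists E : set 'cV[rat]_2, thin E /\
    forall z, ~ E z -> sublinear (fun t k => pgem k%:Z (iter t F z)).
Proof.
move=> root_la la0 vla.
have [l l0 lM] : exists2 l : 'rV[rat]_2, l != 0 & l *m (M - la%:M) = 0.
  apply/det0P; rewrite -root_la !det2 tr2 !mxE /= !mulr1n !mulr0n; apply/eqP; ring.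
have {}lM : l *m M = la *: l.
  by apply/eqP; rewrite -subr_eq0 -mul_mx_scalar -mulmxBr lM.
pose sg := (l *m s) 0 0.
pose E c := [set z : 'cV[rat]_2 | (l *m z) 0 0 = c].
exists (E 0 `|` E sg `|` E (sg / (1 - la))); split.
  by apply: thinU; [apply: thinU|]; exact: thin_line.
move=> z /not_orP[/not_orP[z0 zs] zc].
pose xi t := (l *m iter t F z) 0 0.
have rec t : xi t.+1 = la * xi t + sg.
  by rewrite /xi /= /affine_map mulmxDr mulmxA lM -scalemxAl mxE [in LHS]mxE.
have [C hC] := pgem_neg p_prime l.
apply: (sublinear_shift (P := fun t k => pge k%:Z (xi t)) (C := C)); last first.
  move=> t k h; have := pgem_mul p_prime hC h => /(_ 0 0).
  by apply: pge_le; lia.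
by apply: (scalar_affine p_prime rec la0 vla) => [||_]; apply/eqP.
Qed.

(** The case of growth rate zero: nothing forces the orbit away from the origin, and only
    Diophantine approximation limits how close it comes. *)
Lemma critical_sublinear : s != 0 -> D != 0 ->
  (vp D = 0 /\ pge 0 T) \/ [/\ T != 0, vp T = 0 & 0 < vp D] ->
  exists E : set 'cV[rat]_2, thin E /\
    forall z, ~ E z -> sublinear (fun t k => pgem k%:Z (iter t F z)).
Proof.
move=> s0 D0 cases.
have [[la root_la]|irr] := pselect (exists la : rat, la ^+ 2 - T * la + D = 0).
  have [|||mu [root_mu mu0 vmu]] := unit_root D0 _ _ _ root_la.
  - by case: cases => [[]|[T0 vT _]] //; rewrite pge_vp // vT.
  - by case: cases => [[-> _]|[_ _ /ltW]].
  - by case: cases => [[-> _]|[T0 vT _]]; [left|right].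
  exact: eigenvalue_sublinear root_mu mu0 vmu.
apply: irreducible_sublinear => // [la|].
  by apply/eqP => root_la; apply: irr; exists la.
by case: cases => [|[_ _ ?]]; [left|right].
Qed.

Section Limit.
Variable R : realType.

Lemma height_limit (G : 'cV[rat]_2 -> 'cV[rat]_2) (z : 'cV[rat]_2) (b : int) :
  (exists C : nat, forall (t : nat) (k : int),
     2 * k + C%:Z <= t%:Z * b -> pgem k (iter t G z)) ->
  (forall e : nat, exists t0 : nat, forall (t : nat) (k : int), (t0 <= t)%N ->
     pgem k (iter t G z) -> e%:Z * (2 * k - t%:Z * b) <= t%:Z) ->
  has_padic_height p G z (- b%:~R / 2%:R : R)%:E.
Proof.
move=> [C low] up; pose x t := iter t G z.
have [t1 up1] := up 1%N.
have fin t : (t1 <= t)%N -> exists v : int,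
    padic_val2 R p (x t) = (v%:~R)%:E /\ forall k, pgem k (x t) <-> k <= v.
  move=> ht; have x0 : x t != 0.
    apply/eqP => x0; have : pgem (t%:Z + `|t%:Z * b| + 1) (iter t G z).
      by rewrite -/(x t) x0; exact: pgem0.
    by move=> /(up1 _ _ ht); lia.
  have [v hv] := pgem_max p x0; exists v; split=> //; exact: padic_val2_pgem.
rewrite /has_padic_height; apply: cvg_EFin.
  near=> t; have ht : (t1 <= t)%N by near: t; exact: nbhs_infty_ge.
  by have [v [-> _]] := fin t ht; rewrite -EFinM.
apply/cvgrPdist_le => eps eps0.
pose e := (Num.trunc eps^-1).+1.
have he : (e%:R : R)^-1 <= eps.
  by rewrite invf_ple ?posrE // ltW // truncnS_gt.
have [t2 up2] := up e.
near=> t.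
have ht1 : (t1 <= t)%N by near: t; exact: nbhs_infty_ge.
have ht2 : (t2 <= t)%N by near: t; exact: nbhs_infty_ge.
have ht3 : (e * C.+2 <= t)%N by near: t; exact: nbhs_infty_ge.
have ht4 : (0 < t)%N by near: t; exact: nbhs_infty_gt.
have [v [ev hv]] := fin t ht1; rewrite /= -/(x t) ev /=.
have h1 : e%:Z * (2 * v - t%:Z * b) <= t%:Z by apply: up2 => //; apply/hv.
have h2 : - t%:Z <= e%:Z * (2 * v - t%:Z * b).
  have : t%:Z * b - C%:Z - 2 <= 2 * v.
    have : ((t%:Z * b - C%:Z) %/ 2)%Z <= v by apply/hv; apply: low; lia.
    by lia.
  by move: ht3; nia.
have tR : (0 : R) < t%:R by rewrite ltr0n.
have eR : (0 : R) < e%:R by rewrite ltr0n.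
have -> : - b%:~R / 2%:R - - t%:R^-1 * v%:~R = (2 * v - t%:Z * b)%:~R / (2%:R * t%:R) :> R.
  by rewrite rmorphB !rmorphM /= -pmulrn; field; rewrite gt_eqF.
apply: le_trans he; rewrite normrM normfV [`|2 * t%:R|]gtr0_norm ?mulr_gt0 //.
rewrite ler_pdivrMr ?mulr_gt0 // -(ler_pM2l eR) mulrA mulfV ?gt_eqF // mul1r.
have : e%:Z * `|2 * v - t%:Z * b| <= 2 * t%:Z.
  by move: h1 h2; case: (lerP 0 (2 * v - t%:Z * b)); nia.
by rewrite -(ler_int R) !rmorphM /= -intr_norm -!pmulrn.
Unshelve. all: by end_near.
Qed.

Lemma upper_const (x : nat -> 'cV[rat]_2) (b : int) :
  (exists C t0 : nat, forall (t : nat) (k : int), (t0 <= t)%N ->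
    pgem k (x t) -> 2 * k <= t%:Z * b + C%:Z) ->
  forall e : nat, exists t0 : nat, forall (t : nat) (k : int), (t0 <= t)%N ->
     pgem k (x t) -> e%:Z * (2 * k - t%:Z * b) <= t%:Z.
Proof.
move=> [C [t0 h]] e; exists (t0 + e * C)%N => t k ht hk.
have := h t k _ hk; have -> : (t0 <= t)%N by lia.
by move=> /(_ isT); nia.
Qed.

Lemma upper_sublinear (x : nat -> 'cV[rat]_2) :
  sublinear (fun t k => pgem k%:Z (x t)) ->
  forall e : nat, exists t0 : nat, forall (t : nat) (k : int), (t0 <= t)%N ->
     pgem k (x t) -> e%:Z * (2 * k - t%:Z * 0) <= t%:Z.
Proof.
move=> sub e; have [t0 h] := sub (2 * e)%N; exists t0 => t [k|k] ht hk; last by nia.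
by have := h t k ht hk; nia.
Qed.

(** [a] is twice the valuation of the p-adically dominant eigenvalue, doubled because this
    valuation may be half an odd integer. *)
Definition rate_spec (a : int) : Prop :=
  (a = vp D /\ (T = 0 \/ a <= 2 * vp T)) \/ [/\ T != 0, a = 2 * vp T & a < vp D].

Lemma rate_bounds a : rate_spec a -> (T = 0 \/ a <= 2 * vp T) /\ (D = 0 \/ a <= vp D).
Proof.
move=> [[-> hT]|[T0 -> hD]]; split=> //; right; lia.
Qed.

Lemma linear_height a : s = 0 -> D != 0 -> rate_spec a ->
  exists E : set 'cV[rat]_2, thin E /\
    forall z, ~ E z -> has_padic_height p F z (- a%:~R / 2%:R : R)%:E.
Proof.
move=> s0 D0 ha; have [hT hD] := rate_bounds ha.
have [Exc [E1 E2 E3 _]] := exceptional_directions p_prime D0 ha.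
exists Exc; split.
  apply: collinear_thin => z1 z2 z3 h1 h2 h3.
  by apply: E2; apply: E3.
move=> z zE; apply: height_limit.
  have [C hC] := pow_lower p_prime hT hD; have [C1 hC1] := pgem_neg p_prime z.
  exists (C + 2 * C1)%N => t k hk; rewrite orbit_linear //.
  rewrite -(subrK (- C1%:Z) k); apply: pgem_mul => //.
  by apply: hC; lia.
apply: upper_const; have [C [t0 h]] := E1 z zE.
by exists C, t0 => t k ht; rewrite orbit_linear //; exact: h.
Qed.

(** If [a] is negative the orbit leaves along the dominant eigenvalue, if [a] is positive it
    converges to a nonzero fixed point, and [a = 0] is the critical case. *)
Lemma affine_height a : s != 0 -> D != 0 -> rate_spec a ->
  exists E : set 'cV[rat]_2, thin E /\
    forall z, ~ E z -> has_padic_height p F z (- (Order.min a 0)%:~R / 2%:R : R)%:E.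
Proof.
move=> s0 D0 ha; have [hT hD] := rate_bounds ha.
have lower b z : b <= a -> b <= 0 -> exists C : nat, forall (t : nat) (k : int),
  2 * k + C%:Z <= t%:Z * b -> pgem k (iter t F z) by exact: orbit_lower hT hD.
have [a_neg|a_pos|a0] := ltrgtP a 0.
- have [Exc [E1 E2 E3 E4]] := exceptional_directions p_prime D0 ha.
  exists [set z | Exc ((M - 1) *m z + s)]; split; last first.
    move=> z zE; apply: height_limit; first by apply: lower => //; exact: ltW.
    apply: upper_const; apply: expanding_upper => //; exact: E1.
  apply: collinear_thin => z1 z2 z3 /= h1 h2 h3.
  have diff z z' : Exc ((M - 1) *m z + s) -> Exc ((M - 1) *m z' + s) -> Exc ((M - 1) *m (z - z')).
    move=> h h'; have := E3 _ _ h h'.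
    by rewrite opprD addrACA subrr addr0 -mulmxBr.
  have d2 := diff _ _ h2 h1; have d3 := diff _ _ h3 h1.
  have [det0|det0] := eqVneq (\det (M - 1)) 0; last first.
    have /eqP := E2 _ _ d2 d3; rewrite cross_mulmx mulf_eq0 (negPf det0) => /eqP.
    by [].
  (* Here 1 is an eigenvalue: the differences lie in the kernel of [M - 1], a line because
     [M = 1] would give a rate that is not negative. *)
  have k2 := E4 a_neg det0 _ d2; have k3 := E4 a_neg det0 _ d3.
  have [i ri] : exists i, row i (M - 1) != 0.
    apply/existsP; apply: contraLR a_neg; rewrite negb_exists => /forallP h.
    have M1 : M = 1.
      apply/eqP; rewrite -subr_eq0; apply/eqP/row_matrixP => i; rewrite row0.
      by have := h i; rewrite negbK => /eqP.
    rewrite -leNgt; case: ha => [[-> _]|[T0 -> _]]; first by rewrite M1 det1 vp1.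
    have : pge 0 T by rewrite M1 mxtrace1; exact: pge_nat.
    by rewrite pge_vp // => h0; lia.
  by apply: (kernel_cross ri); rewrite -row_mul ?k2 ?k3 row0.
- exists set0; split; first exact: (thin_sub (@sub0set _ [set 0]) (thin1 _)).
  move=> z _; apply: height_limit; first by apply: lower => //; exact: ltW.
  apply: upper_const; have [C [t0 h]] := contracting_upper p_prime z a_pos s0 hT hD.
  by exists C, t0 => t k ht hk; rewrite mulr0 add0r; exact: h hk.
have [|E [thinE hE]] := critical_sublinear s0 D0.
  case: ha => [[aD hT']|[T0 aT aD]]; [left|right].
    split; first by rewrite -aD.
    case: hT' => [->|h]; first exact: pge0.
    by rewrite /pge; apply/orP; right; lia.
  by split=> //; lia.
exists E; split=> // z zE; rewrite a0; apply: height_limit; first by apply: lower; rewrite ?a0.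
by apply: upper_sublinear; exact: hE.
Qed.

End Limit.

End Heights.

Lemma padic_val_vp (R : realType) (p : nat) (x : rat) : x != 0 ->
  padic_val R p x = ((vp p x)%:~R)%:E.
Proof. by move=> /negPf x0; rewrite /padic_val x0 /vp rmorphB /= -!pmulrn. Qed.

Lemma almost_all_outside (R : realType) (E : set 'cV[rat]_2) (P : 'cV[rat]_2 -> Prop) :
  thin E -> (forall z, ~ E z -> P z) -> almost_all R setT P.
Proof.
move=> thinE h; apply: thin_almost_all; apply: (thin_sub _ thinE) => z nP.
by apply: contrapT => zE; apply: nP; exact: h.
Qed.

Unset Implicit Arguments.

Theorem theorem1 (R : realType) (p : nat) (p_prime : prime p)
    (M : 'M[rat]_2) (M_GL : M \in unitmx) (s : 'cV[rat]_2) :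
  let F := affine_map M s in
  let nuT := padic_val R p (\tr M) in
  let nuD := padic_val R p (\det M) in
  (s = 0 ->
    almost_all R setT (fun z =>
      ((2%:E * nuT < nuD)%E -> has_padic_height p F z (- nuT)%E) /\
      ((nuD <= 2%:E * nuT)%E -> has_padic_height p F z (- nuD / 2%:E)%E))) /\
  (s <> 0 ->
    almost_all R setT (fun z =>
      ((2%:E * nuT < nuD)%E -> has_padic_height p F z (maxe (- nuT) 0)%E) /\
      ((nuD <= 2%:E * nuT)%E ->
         has_padic_height p F z (maxe (- nuD / 2%:E) 0)%E))).
Proof.
have D0 : \det M != 0 by move: M_GL; rewrite unitmxE unitfE.
move=> F nuT nuD.
have nuDE : nuD = ((vp p (\det M))%:~R)%:E by exact: padic_val_vp.
have half (x : R) : ((- x%:E) / 2%:E)%E = (- x / 2)%:E.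
  by rewrite -EFinN inver pnatr_eq0 /= -EFinM.
have maxE (x : int) : (maxe ((- x%:~R / 2 : R)%:E) 0)%E = (- (Order.min x 0)%:~R / 2 : R)%:E.
  rewrite -[0%E]/(0%:E) -EFin_max; congr _%:E.
  case: (leP x 0) => hx; [rewrite max_l // | rewrite max_r ?oppr0 ?mul0r //].
    by rewrite divr_ge0 // oppr_ge0 lerz0.
  by rewrite mulNr oppr_le0 divr_ge0 // ler0z ltW.
have [small|large] := boolP (2%:E * nuT < nuD)%E.
- have T0 : \tr M != 0.
    apply/eqP => T0; move: small; rewrite /nuT /padic_val T0 eqxx nuDE.
    by rewrite gt0_muley ?lte_fin // ltNge leey.
  have nuTE : nuT = ((vp p (\tr M))%:~R)%:E by exact: padic_val_vp.
  have ltTD : 2 * vp p (\tr M) < vp p (\det M).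
    move: small; rewrite nuTE nuDE -EFinM lte_fin -(ltr_int R) rmorphM; exact.
  have ha : rate_spec p M (2 * vp p (\tr M)) by right.
  have nuT2 : (- nuT)%E = (- (2 * vp p (\tr M))%:~R / 2 : R)%:E.
    by rewrite nuTE -EFinN rmorphM /=; congr _%:E; field.
  split=> [s0|/eqP s0].
    have [E [thinE hE]] := linear_height p_prime R s0 D0 ha.
    apply: (almost_all_outside thinE) => z zE; rewrite nuT2; split=> [_|]; first exact: hE.
    by rewrite leNgt small.
  have [E [thinE hE]] := affine_height p_prime R s0 D0 ha.
  apply: (almost_all_outside thinE) => z zE; rewrite nuT2 maxE; split=> [_|]; first exact: hE.
  by rewrite leNgt small.
have leDT : (nuD <= 2%:E * nuT)%E by rewrite leNgt.
have ha : rate_spec p M (vp p (\det M)).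
  left; split=> //; have [T0|T0] := eqVneq (\tr M) 0; [by left|right].
  move: leDT; rewrite nuDE /nuT padic_val_vp // -EFinM lee_fin -(ler_int R) rmorphM; exact.
have nuD2 : (- nuD / 2%:E)%E = (- (vp p (\det M))%:~R / 2 : R)%:E by rewrite nuDE half.
split=> [s0|/eqP s0].
  have [E [thinE hE]] := linear_height p_prime R s0 D0 ha.
  apply: (almost_all_outside thinE) => z zE; rewrite nuD2; split=> // _; exact: hE.
have [E [thinE hE]] := affine_height p_prime R s0 D0 ha.
apply: (almost_all_outside thinE) => z zE; rewrite nuD2 maxE; split=> // _; exact: hE.
Qed.
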